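(* Let $1\le q\le\infty$ and let $q^\ast$ be the conjugate exponent ($1/q+1/q^\ast=1$), with the convention $4/q^\ast=0$ when $q=1$. For $w$ in the unit disc let $k_w(z)=\frac{1}{1-\overline{w}z}$. Then, for $p\ge 0$, the inequality $\|k_w\|_p\le\|\psi\|_q$ holds for all $\psi\in L^q(\mathbb{T})$ with $P_+\psi=k_w$ and for all $w$ in the unit disc if and only if $p\le 4/q^\ast$. Moreover, if $\psi$ has minimal $L^q(\mathbb{T})$ norm among all functions with $P_+\psi=k_w$, then $\|\psi\|_q=\|k_w\|_{4/q^\ast}$ holds for all $w$ in the unit disc when $q=1$ or $q=2$, and only for $w=0$ otherwise.
   Context: $\mathbb{T}$ is the unit circle with normalized measure, $\|\cdot\|_p$ the $L^p(\mathbb{T})$ (quasi-)norm for $p>0$, and for a nontrivial function $\varphi$ in a Hardy space $H^p$ ($p>0$), $\|\varphi\|_0:=\exp\left(\int_0^{2\pi}\log|\varphi(e^{i\theta})|\frac{d\theta}{2\pi}\right)$. The Riesz projection is $P_+\psi=\sum_{n\ge0}\widehat\psi(n)e^{in\theta}$. *)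

(* Defs.v *)
(* Functions on the unit circle T are represented
   as functions of the angle theta in [0, 2 pi], with values in R[i]
   (the complex numbers over a realType R, from mathcomp-real-closed). *)
From HB Require Import structures.
From mathcomp Require Import all_boot all_order all_algebra.
From mathcomp Require Import all_classical all_reals all_analysis.
From mathcomp Require Import complex.
Set Implicit Arguments. Unset Strict Implicit. Unset Printing Implicit Defensive.
Import Order.TTheory GRing.Theory Num.Theory.
Local Open Scope classical_set_scope.
Local Open Scope ring_scope.
Local Open Scope complex_scope.

Section Circle.
Context {R : realType}.

Definition circD : set R := `[0, pi *+ 2]%classic.

Lemma measurable_circD : measurable circD.
Proof. exact: measurable_itv. Qed.

Lemma inv2pi_ge0 : 0 <= (pi *+ 2 : R)^-1.
Proof. by rewrite invr_ge0 mulrn_wge0 // pi_ge0. Qed.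

Definition inv2pi : {nonneg R} := NngNum inv2pi_ge0.

Definition circ_measure :=
  mscale inv2pi (mrestr (@lebesgue_measure R) measurable_circD).

Definition cabs (z : R[i]) : R := ComplexField.Normc.normc z.

Definition expi (t : R) : R[i] := cos t +i* sin t.

Definition cconj (z : R[i]) : R[i] := complex.Re z -i* (complex.Im z).

Definition cmeasurable (f : R -> R[i]) : Prop :=
  measurable_fun circD (@complex.Re R \o f) /\ measurable_fun circD (@complex.Im R \o f).

Definition cint (f : R -> R[i]) : R[i] :=
  Rintegral circ_measure setT (@complex.Re R \o f) +i* Rintegral circ_measure setT (@complex.Im R \o f).

Definition fourier (f : R -> R[i]) (n : int) : R[i] :=
  cint (fun t => f t * expi (- (n%:~R * t))).

Definition Lpnorm (p : \bar R) (f : R -> R[i]) : \bar R :=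
  Lnorm circ_measure p (fun t => (cabs (f t))%:E).

Definition L0norm (f : R -> R[i]) : \bar R :=
  expeR (\int[circ_measure]_t (ln (cabs (f t)))%:E)%E.

Definition pnorm (p : R) (f : R -> R[i]) : \bar R :=
  if p == 0 then L0norm f else Lpnorm p%:E f.

Definition inLq (q : \bar R) (f : R -> R[i]) : Prop :=
  cmeasurable f /\ (Lpnorm q f < +oo)%E.

Definition szego (w : R[i]) (t : R) : R[i] := (1 - cconj w * expi t)^-1.

(* P_+ psi = k_w : the nonnegative Fourier coefficients of psi are those of k_w,
   i.e. \hat psi(n) = conj(w)^n for n >= 0 *)
Definition Pplus_is_kernel (psi : R -> R[i]) (w : R[i]) : Prop :=
  forall n : nat, fourier psi n%:Z = cconj w ^+ n.

Definition four_over_conj (q : \bar R) : R :=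
  match q with
  | r%:E => 4 * (1 - r^-1)
  | +oo%E => 4
  | -oo%E => 0
  end.

Definition Lq_minimal (q : \bar R) (w : R[i]) (psi : R -> R[i]) : Prop :=
  inLq q psi /\ Pplus_is_kernel psi w /\
  forall phi, inLq q phi -> Pplus_is_kernel phi w -> (Lpnorm q psi <= Lpnorm q phi)%E.

End Circle.

(* Main.v *)
Require Import Defs.
From HB Require Import structures.
From mathcomp Require Import all_boot all_order all_algebra.
From mathcomp Require Import all_classical all_reals all_analysis.
From mathcomp Require Import measurable_realfun ess_sup_inf.
From mathcomp Require Import complex ring lra.
Set Implicit Arguments. Unset Strict Implicit. Unset Printing Implicit Defensive.
Import Order.TTheory GRing.Theory Num.Theory.
Import numFieldNormedType.Exports.
Local Open Scope classical_set_scope.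
Local Open Scope ring_scope.

(** With [r = |w|^2] and [s = 2/q^*], the minimal norm of [psi] in [L^q] subject
to [P_+ psi = k_w] is [(1 - r)^(-s/2)]: pairing [psi] with the outer function
[(1 - conj w z)^(-s)] gives [(1 - r)^(-s)], and Hoelder's inequality is an
equality for [psi = (1 - r)^(1-s) (1 - conj w z)^(-1) (1 - w conj z)^(s-1)].
On the other side, by Parseval, [||k_w||_p^p] is the sum of [c_(p/2)(n)^2 r^n],
where [c_s(n) = s (s+1) ... (s+n-1) / n!].  The factorwise inequality
[(s+k)^2 <= (s^2+k) (k+1)], that is [k (s-1)^2 >= 0], yields
[c_s(n)^2 <= c_(s^2)(n)], whence [||k_w||_p <= (1 - r)^(-p/4)] for all [p > 0],
with equality only for [r = 0] or [p = 2].  Comparing the coefficients of [r]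
at [r = 0] shows that [p <= 2s] is also necessary. *)

(** * Binomial coefficients and real power series *)

Section PowerSeries.
Context {R : realType}.
Implicit Types (a : R^nat) (x y s : R).

(** The exponent [s] is the one for which the power [q^*] of [|1 - conj w z|^(-s)] is
    [|1 - conj w z|^(-2)], the only power whose mean has to be known in closed form, [1/(1 - r)].
    For [1 < q < oo], equality in Hoelder's inequality then fixes [psi] up to a positive constant:
    it has the argument of [(1 - conj w z)^(-s)] and modulus proportional to [|1 - conj w z|^(s-2)].
    The product of an analytic and an antianalytic power in the overview has exactly these, and its
    coefficients can be computed.

    No complex power is ever taken, so no branch of the logarithm has to be chosen: [(1 - z)^(-s)]
    is the sum of its binomial series, of which only the coefficients and the modulus are used. The
    modulus comes from a differential equation on rays, which reduces to real power series. All
    coefficient computations go through one pairing, integrated term by term.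

    The case [p = 0] is out of reach of Parseval; [||k_w||_0 = 1] is extracted from the bounds on
    the means for exponents near [0]. *)

Definition bounded_terms a x := exists C, forall n, `|a n| * x ^+ n <= C.

(** The factor [n+1] is absorbed by the gap between [y] and [x]: if [x = y (1 + d)], Bernoulli's
    inequality gives [(n+1) d <= (x/y)^(n+1)]. *)
Lemma bounded_terms_diffs a x y : 0 < y -> y < x ->
  bounded_terms a x -> bounded_terms (pseries_diffs a) y.
Proof.
move=> y0 yx [C aC].
have x0 : 0 < x by exact: lt_trans yx.
have C0 : 0 <= C by apply: le_trans (aC 0); rewrite mulr_ge0// exprn_ge0// ltW.
pose d := x / y - 1.
have d0 : 0 < d by rewrite subr_gt0 ltr_pdivlMr ?mul1r.
have dE : x = y * (1 + d) by rewrite /d addrC subrK mulrC divfK ?gt_eqF.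
have bern n : 1 + n%:R * d <= (1 + d) ^+ n.
  elim: n => [|n IH]; first by rewrite mul0r addr0 expr0.
  rewrite exprS; apply: le_trans (_ : (1 + d) * (1 + n%:R * d) <= _).
    rewrite -natr1 -subr_ge0 [leRHS](_ : _ = n%:R * d * d); last by ring.
    by rewrite !mulr_ge0// ltW.
  by rewrite ler_wpM2l// addr_ge0// ltW.
exists (C / (y * d)) => n.
rewrite /pseries_diffs normrM normr_nat ler_pdivlMr ?mulr_gt0//.
apply: le_trans (aC n.+1); rewrite [in leRHS]dE exprMn.
rewrite [leLHS](_ : _ = `|a n.+1| * (y ^+ n.+1 * (n.+1%:R * d))); last first.
  by rewrite exprS; ring.
do 2! (rewrite ler_wpM2l ?exprn_ge0 ?(ltW y0)//).
by apply: le_trans (bern n.+1); rewrite lerDr.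
Qed.

Lemma bounded_terms_cvg_norm a x y : bounded_terms a x -> 0 <= y -> y < x ->
  cvgn [series `|a n| * y ^+ n]_n.
Proof.
move=> [C aC] y0 yx; have x0 : 0 < x by exact: le_lt_trans yx.
apply: (@series_le_cvg _ _ (fun n => C * (y / x) ^+ n)).
- by move=> n; rewrite mulr_ge0// exprn_ge0.
- move=> n; rewrite mulr_ge0// ?exprn_ge0 ?divr_ge0// ?(ltW x0)//.
  by apply: le_trans (aC 0); rewrite mulr_ge0// exprn_ge0// ltW.
- move=> n; rewrite expr_div_n mulrA ler_pdivlMr ?exprn_gt0//.
  by rewrite mulrAC ler_wpM2r ?exprn_ge0.
- apply: is_cvg_geometric_series.
  by rewrite ger0_norm ?divr_ge0// ?(ltW x0)// ltr_pdivrMr// mul1r.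
Qed.

Lemma bounded_terms_cvg a x y : bounded_terms a x -> `|y| < x ->
  cvgn (pseries a y).
Proof.
move=> ba yx; apply: normed_cvg.
have := bounded_terms_cvg_norm ba (normr_ge0 y) yx.
rewrite [X in cvgn (series X) -> _](_ : _ = (fun n => `|a n * y ^+ n|))//.
by apply/funext => n; rewrite normrM normrX.
Qed.

Lemma bounded_terms_is_derive a x y : bounded_terms a x -> `|y| < x ->
  is_derive y (1 : R) (fun y => limn (pseries a y))
    (limn (pseries (pseries_diffs a) y)).
Proof.
move=> ba yx.
have x0 : 0 < x by exact: le_lt_trans yx.
(* Each formal derivation costs a strictly smaller radius. The radii [k i] decrease from [x] towards
   [|y|], so the series and its first two derived series all converge at [k 3]. *)
pose k i : R := `|y| + (x - `|y|) / 2 ^+ i.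
have dpos : 0 < x - `|y| by rewrite subr_gt0.
have kpos i : `|y| < k i by rewrite ltrDl divr_gt0// exprn_gt0.
have kS i : k i.+1 < k i.
  rewrite ltrD2l ltr_pM2l// ltf_pV2 ?posrE ?exprn_gt0//.
  by rewrite exprS ltr_pMl ?exprn_gt0// ltr1n.
have k0 i : 0 < k i by exact: le_lt_trans (kpos i).
have kE i : `|k i| = k i by rewrite gtr0_norm.
have b0 : bounded_terms a (k 0%N) by rewrite /k expr0 divr1 addrC subrK.
have b1 := bounded_terms_diffs (k0 1%N) (kS 0%N) b0.
have b2 := bounded_terms_diffs (k0 2%N) (kS 1%N) b1.
apply: (@pseries_snd_diffs _ _ (k 3%N)).
- apply: bounded_terms_cvg b0 _; rewrite kE.
  exact: lt_trans (kS 2%N) (lt_trans (kS 1%N) (kS 0%N)).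
- by apply: bounded_terms_cvg b1 _; rewrite kE (lt_trans (kS 2%N)).
- by apply: bounded_terms_cvg b2 _; rewrite kE.
- by rewrite kE.
Qed.

(** This is the Euler operator [y d/dy]. Unlike the derived series it keeps the index of each power,
    so it can be combined term by term with the series itself in the differential equations
    below. *)
Lemma bounded_terms_cvg_index a x y : bounded_terms a x -> 0 < x -> `|y| < x ->
  series (fun n => n%:R * a n * y ^+ n) @ \oo -->
    y * limn (pseries (pseries_diffs a) y).
Proof.
move=> ba x0 yx; have [z /andP[yz zx]] : exists z : R, `|y| < z < x.
  by exists ((`|y| + x) / 2); apply/andP; split; lra.
have z0 : 0 < z by exact: le_lt_trans yz.
have bd := bounded_terms_diffs z0 zx ba.
have cd := bounded_terms_cvg bd yz.
rewrite [X in series X](_ : _ = (fun n => y * (n%:R * a n * y ^+ n.-1))); last first.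
  apply/funext => -[|n] /=; first by rewrite !mul0r mulr0.
  by rewrite exprS; ring.
rewrite (_ : series _ =
    (fun n => y * series (fun n => n%:R * a n * y ^+ n.-1) n)); last first.
  by apply/funext => n; rewrite /series/= mulr_sumr.
by apply: cvgM; [exact: cvg_cst|exact: pseries_diffs_equiv].
Qed.

Definition binom_coef s n : R := \prod_(k < n) ((s + k%:R) / k.+1%:R).

Lemma binom_coef0 s : binom_coef s 0 = 1.
Proof. by rewrite /binom_coef big_ord0. Qed.

Lemma binom_coefS s n :
  n.+1%:R * binom_coef s n.+1 = (s + n%:R) * binom_coef s n.
Proof.
rewrite /binom_coef big_ord_recr/= mulrCA [in RHS]mulrC; congr (_ * _).
by rewrite mulrCA divff ?mulr1// pnatr_eq0.
Qed.

Lemma binom_coef_s1 n : binom_coef 1 n = 1.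
Proof.
by rewrite /binom_coef big1// => k _; rewrite nat1r divff// pnatr_eq0.
Qed.

(** The ratio of consecutive terms is at most [(|s| + n) x / (n+1)], which is at most [1] once
    [n >= |s| x / (1 - x)]. From there on the terms decrease, and the finitely many earlier ones are
    bounded by their sum. *)
Lemma bounded_terms_binom_coef s x : 0 < x -> x < 1 ->
  bounded_terms (binom_coef s) x.
Proof.
move=> x0 x1.
pose u n := `|binom_coef s n| * x ^+ n.
have u0 n : 0 <= u n by rewrite mulr_ge0// exprn_ge0// ltW.
pose N := (Num.trunc (`|s| * x / (1 - x))).+1.
have uN n : (N <= n)%N -> u n.+1 <= u n.
  move=> Nn; have n0 : (0 : R) < n.+1%:R by rewrite ltr0n.
  rewrite -(ler_pM2l n0) /u mulrA -{1}(@normr_nat R n.+1) -normrM.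
  rewrite binom_coefS normrM exprS.
  rewrite [leLHS](_ : _ = `|s + n%:R| * x * (`|binom_coef s n| * x ^+ n)); last by ring.
  rewrite ler_wpM2r// ?u0//.
  apply: le_trans (_ : (`|s| + n%:R) * x <= _).
    rewrite ler_wpM2r ?(ltW x0)//; apply: le_trans (ler_normD _ _) _.
    by rewrite normr_nat.
  have : `|s| * x / (1 - x) <= n%:R.
    apply: le_trans (_ : N%:R <= _); last by rewrite ler_nat.
    by apply/ltW/truncnS_gt.
  rewrite ler_pdivrMr ?subr_gt0// -natr1 => h; nra.
exists (\sum_(i < N.+1) u i) => n; rewrite -/(u n).
have sumge i : (i < N.+1)%N -> u i <= \sum_(i < N.+1) u i.
  move=> iN; rewrite (bigD1 (Ordinal iN))//= lerDl.
  by apply: sumr_ge0 => j _; exact: u0.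
have [nN|Nn] := ltnP n N.+1; first exact: sumge.
apply: le_trans (sumge N (ltnSn N)).
rewrite -(subnK (ltnW Nn)); elim: (n - N)%N => [|k IH]; first by rewrite add0n.
by rewrite addSn; apply: le_trans IH; apply: uN; rewrite leq_addl.
Qed.

Lemma binom_coef_sqr_le s n : binom_coef s n ^+ 2 <= binom_coef (s ^+ 2) n.
Proof.
rewrite /binom_coef -prodrXl; apply: ler_prod => k _; rewrite sqr_ge0/=.
rewrite [leLHS](_ : _ = (s + k%:R) ^+ 2 / k.+1%:R / k.+1%:R); last first.
  by rewrite expr_div_n -mulrA -invfM -expr2.
rewrite ler_pM2r ?invr_gt0 ?ltr0n// ler_pdivrMr ?ltr0n// -natr1.
rewrite -subr_ge0 [leRHS](_ : _ = k%:R * (s - 1) ^+ 2); last by ring.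
by rewrite mulr_ge0 ?sqr_ge0.
Qed.

(** Index [2] is the first where strictness can occur: the factors for [k = 0] agree, since the
    defect is [k (s-1)^2]. The condition [s != 0] keeps that common factor from annihilating the
    strict one. *)
Lemma binom_coef2_sqr_lt s : s != 0 -> s != 1 ->
  binom_coef s 2 ^+ 2 < binom_coef (s ^+ 2) 2.
Proof.
move=> s0 s1; rewrite /binom_coef !big_ord_recr !big_ord0/=.
have : 0 < s ^+ 2 by rewrite lt_def sqrf_eq0 s0 sqr_ge0.
have : 0 < (s - 1) ^+ 2 by rewrite lt_def sqrf_eq0 subr_eq0 s1 sqr_ge0.
move=> h1 h2; rewrite !mul1r !addr0 !divr1 exprMn ltr_pM2l//.
by rewrite expr_div_n ltr_pdivrMr ?exprn_gt0//; nra.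
Qed.

Lemma derive0_eq (f : R -> R) (b : R) : 0 <= b ->
  (forall t, 0 <= t -> t <= b -> is_derive t (1 : R) f 0) -> f b = f 0.
Proof.
move=> b0 df.
have [||c _ h] := @MVT_segment R f (cst 0) 0 b b0.
- by move=> t; rewrite in_itv/= => /andP[t0 tb]; apply: df; apply: ltW.
- apply: derivable_within_continuous => t; rewrite in_itv/= => /andP[t0 tb].
  by have [] := df t t0 tb.
- by apply/eqP; rewrite -subr_eq0 h mul0r.
Qed.

End PowerSeries.

(** * The complex binomial series *)

Section ComplexPairs.
Context {R : realType}.
Implicit Types (z w : R[i]) (u v : nat -> R[i]).
Local Open Scope complex_scope.
Local Notation Re := (@complex.Re R).
Local Notation Im := (@complex.Im R).

Definition cabs2 z : R := Re z ^+ 2 + Im z ^+ 2.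

Lemma cabs2_ge0 z : 0 <= cabs2 z.
Proof. by rewrite addr_ge0 ?sqr_ge0. Qed.

Lemma cabsE z : cabs z = Num.sqrt (cabs2 z).
Proof. by case: z. Qed.

Lemma cabs2E z : cabs2 z = cabs z ^+ 2.
Proof. by rewrite cabsE sqr_sqrtr ?cabs2_ge0. Qed.

Lemma cabs_ge0 z : 0 <= cabs z.
Proof. by rewrite cabsE sqrtr_ge0. Qed.

Lemma cabsM z w : cabs (z * w) = cabs z * cabs w.
Proof. exact: ComplexField.Normc.normcM. Qed.

Lemma cabs1 : cabs (1 : R[i]) = 1.
Proof. exact: ComplexField.Normc.normc1. Qed.

Lemma cabsX z n : cabs (z ^+ n) = cabs z ^+ n.
Proof.
by elim: n => [|n IH]; rewrite ?expr0 ?cabs1// !exprS cabsM IH.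
Qed.

Lemma cabsV z : cabs z^-1 = (cabs z)^-1.
Proof. exact: ComplexField.Normc.normcV. Qed.

Lemma cabsD z w : cabs (z + w) <= cabs z + cabs w.
Proof. exact: le_normcD. Qed.

Lemma cabs_real (x : R) : cabs x%:C = `|x|.
Proof. by rewrite cabsE /cabs2/= expr0n addr0 sqrtr_sqr. Qed.

Lemma cabs_conj z : cabs (cconj z) = cabs z.
Proof. by case: z => a b; rewrite !cabsE /cabs2/= sqrrN. Qed.

Lemma cconjE z : cconj z = conjc z.
Proof. by case: z. Qed.

Lemma normr_Re_le z : `|Re z| <= cabs z.
Proof.
by rewrite cabsE -sqrtr_sqr ler_wsqrtr// lerDl sqr_ge0.
Qed.

Lemma normr_Im_le z : `|Im z| <= cabs z.
Proof.
by rewrite cabsE -sqrtr_sqr ler_wsqrtr// lerDr sqr_ge0.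
Qed.

Lemma cReM z w : Re (z * w) = Re z * Re w - Im z * Im w.
Proof. by case: z w => a b [c d]. Qed.

Lemma cImM z w : Im (z * w) = Re z * Im w + Im z * Re w.
Proof. by case: z w => a b [c d]. Qed.

Lemma cReD z w : Re (z + w) = Re z + Re w.
Proof. by case: z w => a b [c d]. Qed.

Lemma cImD z w : Im (z + w) = Im z + Im w.
Proof. by case: z w => a b [c d]. Qed.

Lemma cReN z : Re (- z) = - Re z.
Proof. by case: z. Qed.

Lemma cImN z : Im (- z) = - Im z.
Proof. by case: z. Qed.

Lemma Re_sum (I : Type) (r : seq I) (P : pred I) (F : I -> R[i]) :
  Re (\sum_(i <- r | P i) F i) = \sum_(i <- r | P i) Re (F i).
Proof. by apply: (big_morph _ cReD). Qed.

Lemma Im_sum (I : Type) (r : seq I) (P : pred I) (F : I -> R[i]) :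
  Im (\sum_(i <- r | P i) F i) = \sum_(i <- r | P i) Im (F i).
Proof. by apply: (big_morph _ cImD). Qed.

Lemma cabs_sum (I : Type) (r : seq I) (P : pred I) (F : I -> R[i]) :
  cabs (\sum_(i <- r | P i) F i) <= \sum_(i <- r | P i) cabs (F i).
Proof.
elim/big_ind2 : _ => //; first by rewrite -[0]/(0%:C) cabs_real normr0.
by move=> x1 x2 y1 y2 h1 h2; apply: le_trans (cabsD _ _) (lerD h1 h2).
Qed.

Definition ccvg u z :=
  (Re \o u @ \oo --> Re z) /\ (Im \o u @ \oo --> Im z).

Lemma ccvgM u v z w : ccvg u z -> ccvg v w -> ccvg (fun n => u n * v n) (z * w).
Proof.
move=> [u1 u2] [v1 v2]; split; rewrite ?cReM ?cImM.
  rewrite (_ : _ \o _ = fun n => Re (u n) * Re (v n) - Im (u n) * Im (v n)).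
    by apply: cvgB; apply: cvgM.
  by apply/funext => n /=; rewrite cReM.
rewrite (_ : _ \o _ = fun n => Re (u n) * Im (v n) + Im (u n) * Re (v n)).
  by apply: cvgD; apply: cvgM.
by apply/funext => n /=; rewrite cImM.
Qed.

Lemma ccvg_cst z : ccvg (fun=> z) z.
Proof. by split; apply: cvg_cst. Qed.

Lemma ccvg_conj u z : ccvg u z -> ccvg (fun n => cconj (u n)) (cconj z).
Proof. by move=> [u1 u2]; split => //=; apply: cvgN. Qed.

Lemma ccvg_unique u z w : ccvg u z -> ccvg u w -> z = w.
Proof.
move=> [a b] [c d]; apply/eqP; rewrite eq_complex.
by rewrite (cvg_unique _ a c)// (cvg_unique _ b d)// !eqxx.
Qed.

End ComplexPairs.

(** * Sum and modulus of the binomial series *)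

Section BinomialSeries.
Context {R : realType}.
Implicit Types (s r t : R) (z : R[i]).
Local Open Scope complex_scope.
Local Notation Re := (@complex.Re R).
Local Notation Im := (@complex.Im R).

Lemma mulr_powRB1_gt0 (x s : R) : 0 < x -> x * x `^ (s - 1) = x `^ s.
Proof.
move=> x0; rewrite -{1}(powRr1 (ltW x0)) -powRD; first by rewrite addrC subrK.
by rewrite (gt_eqF x0) implybT.
Qed.

Lemma is_derive_powR_comp (f : R -> R) t s df : 0 < f t ->
  is_derive t (1 : R) f df ->
  is_derive t (1 : R) (fun t => f t `^ s) (s * f t `^ (s - 1) * df).
Proof.
move=> ft dft; have dp := is_derive1_powR s ft.
exact: (@is_derive1_comp R (@powR R ^~ s) f t _ _ dp dft).
Qed.

(** The recurrence [binom_coefS] says that the sum [u] solves [(1 - t) u' = s u], so [u (1 - t)^s]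
    has zero derivative on [[0, r]] and keeps its value [1] at [0]. *)
Lemma binom_series s r : 0 <= r -> r < 1 ->
  pseries (binom_coef s) r @ \oo --> (1 - r) `^ (- s).
Proof.
move=> r0 r1; pose x := (1 + r) / 2.
have rx : r < x by rewrite /x; lra.
have x0 : 0 < x by exact: le_lt_trans rx.
have bx : bounded_terms (binom_coef s) x.
  by apply: bounded_terms_binom_coef => //; rewrite /x; lra.
have rn : `|r| < x by rewrite ger0_norm.
pose u t := limn (pseries (binom_coef s) t).
pose u' t := limn (pseries (pseries_diffs (binom_coef s)) t).
have ode t : `|t| < x -> (1 - t) * u' t = s * u t.
  move=> tx; rewrite mulrBl mul1r; apply/eqP; rewrite subr_eq; apply/eqP.
  have c1 := bounded_terms_cvg bx tx.
  have c2 := bounded_terms_cvg_index bx x0 tx.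
  apply: cvg_lim => //.
  rewrite (_ : pseries _ t = (fun n => s * pseries (binom_coef s) t n +
      series (fun n => n%:R * binom_coef s n * t ^+ n) n)); last first.
    apply/funext => n; rewrite /pseries /series/= mulr_sumr -big_split/=.
    by apply: eq_bigr => k _; rewrite /pseries_diffs binom_coefS; ring.
  by apply: cvgD => //; apply: cvgM => //; exact: cvg_cst.
have key : u r * (1 - r) `^ s = 1.
  pose f t := u t * (1 - t) `^ s.
  have fr : f r = f 0.
    apply: derive0_eq => // t t0 tr.
    have tx : `|t| < x by rewrite ger0_norm// (le_lt_trans tr).
    have d1 : is_derive t (1 : R) u (u' t) := bounded_terms_is_derive bx tx.
    have t1 : 0 < 1 - t by rewrite subr_gt0 (le_lt_trans tr).
    have d2 : is_derive t (1 : R) (fun t => (1 - t) `^ s)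
        (s * (1 - t) `^ (s - 1) * (0 - 1)).
      have d3 : is_derive t (1 : R) (fun t => 1 - t) (0 - 1).
        exact: is_deriveB.
      exact: is_derive_powR_comp.
    apply: is_derive_eq; rewrite /GRing.scale/=.
    have -> : (1 - t) `^ s = (1 - t) * (1 - t) `^ (s - 1).
      by rewrite mulr_powRB1_gt0.
    have := ode t tx; set e := _ `^ _ => h.
    rewrite [LHS](_ : _ = e * ((1 - t) * u' t - s * u t)); last by ring.
    by rewrite h subrr mulr0.
  rewrite -[LHS]/(f r) fr /f subr0 powR1 mulr1; apply: cvg_lim => //.
  (* At [t = 0] every partial sum except the empty one equals the constant coefficient, hence the
     shift by one. *)
  rewrite -cvg_shiftS /=; apply: cvg_near_cst; apply: nearW => n.
  rewrite /pseries /series/= big_nat_recl//= binom_coef0 expr0 mulr1.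
  by rewrite big1 ?addr0// => i _; rewrite exprS mul0r mulr0.
have -> : (1 - r) `^ (- s) = u r.
  have p0 : (1 - r) `^ s != 0 by rewrite gt_eqF// powR_gt0// subr_gt0.
  by apply: (mulIf p0); rewrite powRN mulVf// key.
exact: bounded_terms_cvg bx rn.
Qed.

Definition binom_part s z n : R[i] :=
  \sum_(0 <= k < n) (binom_coef s k)%:C * z ^+ k.

(** For [|z| < 1] this is the principal branch of [(1 - z)^(-s)], for [s] of either sign. *)
Definition binom_fun s z : R[i] :=
  limn (Re \o binom_part s z) +i* limn (Im \o binom_part s z).

(** With [z] fixed, the series along the ray [t z] splits into real power series in [t], to which
    the termwise calculus of [bounded_terms] applies. *)
Lemma Re_binom_part s z t n : Re (binom_part s (t%:C * z) n) =
  pseries (fun k => binom_coef s k * Re (z ^+ k)) t n.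
Proof.
rewrite /pseries /series/= Re_sum; apply: eq_bigr => k _.
by rewrite exprMn -rmorphXn !cReM !cImM/=; ring.
Qed.

Lemma Im_binom_part s z t n : Im (binom_part s (t%:C * z) n) =
  pseries (fun k => binom_coef s k * Im (z ^+ k)) t n.
Proof.
rewrite /pseries /series/= Im_sum; apply: eq_bigr => k _.
by rewrite exprMn -rmorphXn !cImM !cReM/=; ring.
Qed.

(** The bound is uniform in the truncation as well as in [z], which makes it a constant majorant for
    dominated convergence on the circle. *)
Lemma binom_part_bound s r : 0 <= r -> r < 1 ->
  exists B, forall z n, cabs z <= r -> cabs (binom_part s z n) <= B.
Proof.
move=> r0 r1; pose x := (1 + r) / 2.
have rx : r < x by rewrite /x; lra.
have bx : bounded_terms (binom_coef s) x.
  by apply: bounded_terms_binom_coef => //; rewrite /x; lra.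
have := bounded_terms_cvg_norm bx r0 rx.
set v := (X in series X) => cv.
exists (limn (series v)) => z n zr.
apply: (@le_trans _ _ (series v n)); last first.
  apply: nondecreasing_cvgn_le => //; apply: nondecreasing_series => k _ _.
  by rewrite /v mulr_ge0// exprn_ge0.
apply: le_trans (cabs_sum _ _ _) _; apply: ler_sum => k _.
rewrite cabsM cabs_real cabsX /v ler_wpM2l//.
by apply: lerXn2r => //; rewrite nnegrE ?cabs_ge0.
Qed.

(** A radius beyond [1] makes [t = 1], that is the point [z] itself, interior to the domain of the
    series along the ray. *)
Lemma bounded_terms_binom_Re_Im s z : cabs z < 1 -> exists2 x, 1 < x &
  bounded_terms (fun k => binom_coef s k * Re (z ^+ k)) x /\
  bounded_terms (fun k => binom_coef s k * Im (z ^+ k)) x.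
Proof.
move=> z1; pose y := (1 + cabs z) / 2; have z0 := cabs_ge0 z.
have zy : cabs z < y by rewrite /y; lra.
have y0 : 0 < y by rewrite /y; lra.
have y1 : y < 1 by rewrite /y; lra.
(* Since [|z| < y < 1], this gives [x > 1] while [y x = 2 y / (1 + y)] stays below [1], where the
   binomial terms are bounded. *)
pose x := 2 / (1 + y).
have x1 : 1 < x by rewrite ltr_pdivlMr; lra.
have yx0 : 0 < y * x by rewrite mulr_gt0// (lt_trans ltr01).
have yx1 : y * x < 1 by rewrite /x mulrA ltr_pdivrMr; lra.
have [C hC] := bounded_terms_binom_coef s yx0 yx1.
have x0 := lt_trans ltr01 x1; move: (x) x1 x0 hC => {yx0 yx1}x x1 x0 hC.
exists x => //; split; exists C => n; apply: le_trans (hC n);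
  rewrite normrM exprMn -mulrA ler_wpM2l// ler_wpM2r ?exprn_ge0 ?(ltW x0)//.
- apply: le_trans (normr_Re_le _) _; rewrite cabsX.
  by rewrite lerXn2r ?nnegrE ?cabs_ge0 ?(ltW y0) ?(ltW zy).
- apply: le_trans (normr_Im_le _) _; rewrite cabsX.
  by rewrite lerXn2r ?nnegrE ?cabs_ge0 ?(ltW y0) ?(ltW zy).
Qed.

Lemma binom_part_cvg s z : cabs z < 1 ->
  ccvg (binom_part s z) (binom_fun s z).
Proof.
move=> z1; have [x x1 [bR bI]] := bounded_terms_binom_Re_Im s z1.
split => /=.
- rewrite [X in cvgn X](_ : _ = pseries (fun k => binom_coef s k * Re (z ^+ k)) 1).
    by apply: bounded_terms_cvg bR _; rewrite normr1.
  by apply/funext => n /=; rewrite -Re_binom_part mul1r.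
- rewrite [X in cvgn X](_ : _ = pseries (fun k => binom_coef s k * Im (z ^+ k)) 1).
    by apply: bounded_terms_cvg bI _; rewrite normr1.
  by apply/funext => n /=; rewrite -Im_binom_part mul1r.
Qed.

(* Along the ray [t z] the sum [h] solves [(1 - t z) h' = s z h], so
   [|h|^2 |1 - t z|^(2 s)] is constant. *)
Lemma cabs2_binom_fun s z : cabs z < 1 ->
  cabs2 (binom_fun s z) = cabs2 (1 - z) `^ (- s).
Proof.
move=> z1; have [X X1 [bA bB]] := bounded_terms_binom_Re_Im s z1.
have X0 : 0 < X by exact: lt_trans X1.
set A := (X in bounded_terms X _) in bA; set B := (X in bounded_terms X _) in bB.
pose x := Re z; pose y := Im z.
pose u t := limn (pseries A t); pose v t := limn (pseries B t).
pose u' t := limn (pseries (pseries_diffs A) t).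
pose v' t := limn (pseries (pseries_diffs B) t).
have AS k : pseries_diffs A k =
    x * (k%:R * A k + s * A k) - y * (k%:R * B k + s * B k).
  by rewrite /pseries_diffs /A /B mulrA binom_coefS exprS cReM -/x -/y; ring.
have BS k : pseries_diffs B k =
    x * (k%:R * B k + s * B k) + y * (k%:R * A k + s * A k).
  by rewrite /pseries_diffs /A /B mulrA binom_coefS exprS cImM -/x -/y; ring.
have term (a : R^nat) t : bounded_terms a X -> `|t| < X ->
    (fun n => \sum_(0 <= k < n) (k%:R * a k + s * a k) * t ^+ k) @ \oo -->
    t * limn (pseries (pseries_diffs a) t) + s * limn (pseries a t).
  move=> ba tX.
  rewrite [X in X @ _](_ : _ = (fun n => series (fun n => n%:R * a n * t ^+ n) n
      + s * pseries a t n)); last first.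
    apply/funext => n; rewrite /pseries /series/= mulr_sumr -big_split/=.
    by apply: eq_bigr => k _; ring.
  apply: cvgD; first exact: (bounded_terms_cvg_index ba X0 tX).
  by apply: cvgM; [exact: cvg_cst|exact: bounded_terms_cvg ba tX].
(* [odeu] and [odev] are the real and imaginary parts of [h' = z (t h' + s h)] with
   [h = u + i v]. *)
have odeu t : `|t| < X ->
    u' t = x * (t * u' t + s * u t) - y * (t * v' t + s * v t).
  move=> tX; apply: cvg_lim => //.
  rewrite [X in X @ _](_ : _ = (fun n =>
      x * (\sum_(0 <= k < n) (k%:R * A k + s * A k) * t ^+ k) -
      y * (\sum_(0 <= k < n) (k%:R * B k + s * B k) * t ^+ k))); last first.
    apply/funext => n; rewrite /pseries /series/= !mulr_sumr -sumrB.
    by apply: eq_bigr => k _; rewrite AS; ring.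
  by apply: cvgB; apply: cvgM; (try exact: cvg_cst); exact: term.
have odev t : `|t| < X ->
    v' t = x * (t * v' t + s * v t) + y * (t * u' t + s * u t).
  move=> tX; apply: cvg_lim => //.
  rewrite [X in X @ _](_ : _ = (fun n =>
      x * (\sum_(0 <= k < n) (k%:R * B k + s * B k) * t ^+ k) +
      y * (\sum_(0 <= k < n) (k%:R * A k + s * A k) * t ^+ k))); last first.
    apply/funext => n; rewrite /pseries /series/= !mulr_sumr -big_split.
    by apply: eq_bigr => k _; rewrite /= BS; ring.
  by apply: cvgD; apply: cvgM; (try exact: cvg_cst); exact: term.
pose E t := (1 - t * x) ^+ 2 + (t * y) ^+ 2.
have E0 t : 0 <= t -> t <= 1 -> 0 < E t.
  move=> t0 t1; rewrite lt_def addr_ge0 ?sqr_ge0// andbT.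
  rewrite paddr_eq0 ?sqr_ge0// negb_and !sqrf_eq0 subr_eq0; apply/orP; left.
  rewrite eq_sym lt_eqF//; apply: le_lt_trans z1.
  apply: le_trans (normr_Re_le z); rewrite -/x.
  apply: le_trans (_ : t * `|x| <= _); first by rewrite ler_wpM2l// ler_norm.
  by rewrite ler_piMl.
pose g t := (u t ^+ 2 + v t ^+ 2) * E t `^ s.
have gc : g 1 = g 0.
  apply: (derive0_eq ler01) => t t0 t1.
  have tX : `|t| < X by rewrite ger0_norm// (le_lt_trans t1).
  have du : is_derive t (1 : R) u (u' t) := bounded_terms_is_derive bA tX.
  have dv : is_derive t (1 : R) v (v' t) := bounded_terms_is_derive bB tX.
  have dE : is_derive t (1 : R) E (2 * t * (x ^+ 2 + y ^+ 2) - 2 * x).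
    rewrite /E; apply: is_derive_eq; rewrite /GRing.scale/=; ring.
  have dEs : is_derive t (1 : R) (fun t => E t `^ s)
      (s * E t `^ (s - 1) * (2 * t * (x ^+ 2 + y ^+ 2) - 2 * x)).
    exact: (@is_derive_powR_comp E t s _ (E0 t t0 t1) dE).
  apply: is_derive_eq; rewrite /GRing.scale/=.
  have -> : E t `^ s = E t * E t `^ (s - 1).
    by rewrite mulr_powRB1_gt0// E0.
  set e := E t `^ _.
  have e1 := odeu t tX; have e2 := odev t tX.
  (* [p + i q] is [(1 - t z) h]. Up to the factor [2 E^(s-1)], the derivative of [g] is the real
     part of [conj ((1 - t z) h) ((1 - t z) h' - s z h)], whose last factor vanishes by the
     differential equation. *)
  pose p := (1 - t * x) * u t + t * y * v t.
  pose q := (1 - t * x) * v t - t * y * u t.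
  rewrite [LHS](_ : _ = 2 * e * (
    p * (u' t - (x * (t * u' t + s * u t) - y * (t * v' t + s * v t))) +
    q * (v' t - (x * (t * v' t + s * v t) + y * (t * u' t + s * u t))))).
    by rewrite -e1 -e2 !subrr !mulr0 addr0 mulr0.
  rewrite /p /q /E; ring.
have [A0 B0] : A 0 = 1 /\ B 0 = 0.
  by rewrite /A /B !expr0 binom_coef0/= mulr1 mulr0.
have val0 (a : R^nat) : limn (pseries a 0) = a 0.
  apply: cvg_lim => //.
  rewrite -cvg_shiftS /=; apply: cvg_near_cst; apply: nearW => n.
  rewrite /pseries /series/= big_nat_recl//= expr0 mulr1.
  by rewrite big1 ?addr0// => i _; rewrite exprS mul0r mulr0.
have E1 : cabs2 (1 - z) = E 1.
  by rewrite /cabs2 /E cReD cImD cReN cImN/= mul1r -/x -/y; ring.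
have uv1 : cabs2 (binom_fun s z) = u 1 ^+ 2 + v 1 ^+ 2.
  rewrite /cabs2 /u /v /binom_fun/=; congr (_ ^+ 2 + _ ^+ 2);
    congr (limn _); apply/funext => n /=.
    by rewrite /A -Re_binom_part mul1r.
  by rewrite /B -Im_binom_part mul1r.
move: gc; rewrite /g /u /v !val0 A0 B0 -/(u 1) -/(v 1) -uv1 -E1.
have -> : E 0 = 1 by rewrite /E !mul0r subr0 expr0n expr1n addr0.
rewrite powR1 expr0n expr1n addr0 mulr1 => h.
have p0 : cabs2 (1 - z) `^ s != 0.
  by rewrite gt_eqF// powR_gt0// E1 E0// ler01.
by apply: (mulIf p0); rewrite powRN mulVf// h.
Qed.

End BinomialSeries.

(** * Integration against the normalized arc length *)

Section ConullIntegral.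
Local Open Scope ereal_scope.
Context d (T : measurableType d) (R : realType).
Variables (mu : {measure set T -> \bar R}) (D : set T).
Hypotheses (mD : measurable D) (muDC : mu (~` D) = 0).
Implicit Types f g : T -> \bar R.

Import HBNNSimple.

Lemma sintegral_conull (h : {nnsfun T >-> R}) :
  sintegral mu h = sintegral mu (h \_ D).
Proof.
have mDC : measurable (~` D) := measurableC mD.
transitivity (\int[mu]_x (h x)%:E).
  by rewrite integral_nnsfun// patch_setT.
rewrite -integral_nnsfun//.
rewrite (@ge0_negligible_integral _ _ _ mu setT (~` D))//.
- by rewrite setTD setCK.
- by apply/measurable_EFinP.
- by move=> x _; rewrite lee_fin.
Qed.

(** The integral of a nonnegative function is a supremum over simple functions below it. Cutting
    such a function down to [D] preserves its integral and puts it below [g]; only the simple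
    function has to be measurable. *)
Let le_integral_conull f g : (forall t, 0 <= f t) -> (forall t, 0 <= g t) ->
    (forall t, D t -> f t = g t) -> \int[mu]_t f t <= \int[mu]_t g t.
Proof.
move=> f0 g0 fg; rewrite (ge0_integralTE mu f0) (ge0_integralTE mu g0).
apply: ge_ereal_sup => _ [h /= hf <-].
apply: ereal_sup_ubound; exists (proj_nnsfun h mD); last first.
  by rewrite -(mrestrict h mD) -sintegral_conull.
rewrite /mkset -(mrestrict h mD) => t.
rewrite patchE; case: ifPn => [|_]; last exact: g0.
by rewrite inE => Dt; rewrite -fg.
Qed.

(* No measurability is assumed: [cmeasurable] constrains a function on
   [0, 2 pi] only. *)
Lemma eq_integral_conull f g : (forall t, D t -> f t = g t) ->
  \int[mu]_t f t = \int[mu]_t g t.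
Proof.
move=> fg; rewrite integralE [RHS]integralE; congr (_ - _);
  apply/eqP; rewrite eq_le; apply/andP;
  split; apply: le_integral_conull => // t Dt; rewrite ?funeposE ?funenegE fg//.
Qed.

End ConullIntegral.

Section CircleMeasure.
Context {R : realType}.
Local Notation mu := (@circ_measure R).
Local Notation D := (@circD R).

Lemma circ_measureC : mu (~` D) = 0%E.
Proof. by rewrite /circ_measure/= /mscale/= /mrestr setICl measure0 mule0. Qed.

Lemma circ_measureT : mu setT = 1%E.
Proof.
rewrite /circ_measure/= /mscale/= /mrestr setTI /circD lebesgue_measure_itv/=.
rewrite lte_fin mulrn_wgt0 ?pi_gt0// sube0 -EFinM mulVf// gt_eqF//.
by rewrite mulrn_wgt0 ?pi_gt0.
Qed.

Lemma circ_ae (P : R -> Prop) :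
  (forall t, D t -> P t) -> \forall t \ae mu, P t.
Proof.
move=> DP; exists (~` D); split; first exact: measurableC (@measurable_circD R).
  exact: circ_measureC.
by move=> t /= nP Dt; apply: nP; exact: DP.
Qed.

Lemma eq_integral_circ (f g : R -> \bar R) : (forall t, D t -> f t = g t) ->
  (\int[mu]_t f t = \int[mu]_t g t)%E.
Proof.
exact: (@eq_integral_conull _ _ R mu D (@measurable_circD R) circ_measureC f g).
Qed.

Lemma eq_Lpnorm_circ q (f g : R -> R[i]) : (1 <= q)%E ->
  (forall t, D t -> f t = g t) -> Lpnorm q f = Lpnorm q g.
Proof.
move=> q1 fg; rewrite /Lpnorm unlock; case: q q1 => [q| |]// _.
  by congr (_ `^ _)%E; apply: eq_integral_circ => t Dt; rewrite fg.
case: ifPn => // _; apply: eq_ess_sup.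
by apply: circ_ae => t Dt /=; rewrite fg.
Qed.

Lemma eq_fourier_circ (f g : R -> R[i]) n : (forall t, D t -> f t = g t) ->
  fourier f n = fourier g n.
Proof.
move=> fg; rewrite /fourier /cint /Rintegral; congr (fine _ +i* fine _)%C;
  by apply: eq_integral_circ => t Dt /=; rewrite fg.
Qed.

End CircleMeasure.

(** * Integration of complex functions on the circle *)

Section CircleIntegral.
Context {R : realType}.
Local Open Scope complex_scope.
Local Notation mu := (@circ_measure R).
Local Notation Re := (@complex.Re R).
Local Notation Im := (@complex.Im R).
Implicit Types (f g : R -> R[i]) (z w : R[i]) (h : R -> R).

Definition cmeasurableT f :=
  measurable_fun setT (Re \o f) /\ measurable_fun setT (Im \o f).

Definition cintegrable f :=
  mu.-integrable setT (EFin \o (Re \o f)) /\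
  mu.-integrable setT (EFin \o (Im \o f)).

Lemma cmeasurableTM f g : cmeasurableT f -> cmeasurableT g ->
  cmeasurableT (fun t => f t * g t).
Proof.
move=> [f1 f2] [g1 g2]; split.
  rewrite (_ : _ \o _ =
      ((Re \o f) \* (Re \o g)) \- ((Im \o f) \* (Im \o g))).
    by apply: measurable_funB; exact: measurable_funM.
  by apply/funext => t /=; rewrite cReM.
rewrite (_ : _ \o _ = ((Re \o f) \* (Im \o g)) \+ ((Im \o f) \* (Re \o g))).
  by apply: measurable_funD; exact: measurable_funM.
by apply/funext => t /=; rewrite cImM.
Qed.

Lemma cmeasurableTD f g : cmeasurableT f -> cmeasurableT g ->
  cmeasurableT (fun t => f t + g t).
Proof.
move=> [f1 f2] [g1 g2]; split.
  rewrite (_ : _ \o _ = (Re \o f) \+ (Re \o g)); first exact: measurable_funD.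
  by apply/funext => t /=; rewrite cReD.
rewrite (_ : _ \o _ = (Im \o f) \+ (Im \o g)); first exact: measurable_funD.
by apply/funext => t /=; rewrite cImD.
Qed.

Lemma cmeasurableT_cst z : cmeasurableT (fun=> z).
Proof. by split; exact: measurable_cst. Qed.

Lemma cmeasurableT_conj f : cmeasurableT f -> cmeasurableT (fun t => cconj (f t)).
Proof. by move=> [f1 f2]; split => //; exact: measurableT_comp. Qed.

Lemma cmeasurableT_expi (a : R) : cmeasurableT (fun t => expi (a * t)).
Proof.
split; apply: continuous_measurable_fun => t; apply: continuous_comp.
- by apply: cvgM; [exact: cvg_cst|exact: cvg_id].
- exact: continuous_cos.
- by apply: cvgM; [exact: cvg_cst|exact: cvg_id].
- exact: continuous_sin.
Qed.

Lemma cmeasurableT_cabs2 f : cmeasurableT f ->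
  measurable_fun setT (fun t => cabs2 (f t)).
Proof.
by move=> [f1 f2]; apply: measurable_funD; exact: measurable_funX.
Qed.

Lemma cmeasurableT_cabs f : cmeasurableT f ->
  measurable_fun setT (fun t => cabs (f t)).
Proof.
move=> mf; rewrite (_ : (fun _ => _) = (fun t => cabs2 (f t) `^ (2^-1))).
  apply: (measurableT_comp (measurable_powR _)); exact: cmeasurableT_cabs2.
by apply/funext => t; rewrite powR12_sqrt ?cabs2_ge0// cabsE.
Qed.

Lemma cmeasurableT_cvg (f_ : nat -> R -> R[i]) f :
  (forall n, cmeasurableT (f_ n)) -> (forall t, ccvg (f_ ^~ t) (f t)) ->
  cmeasurableT f.
Proof.
move=> mf cf; split.
- apply: (@measurable_fun_cvg _ _ _ setT (fun n => Re \o f_ n)).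
    by move=> n; case: (mf n).
  by move=> t _; case: (cf t).
- apply: (@measurable_fun_cvg _ _ _ setT (fun n => Im \o f_ n)).
    by move=> n; case: (mf n).
  by move=> t _; case: (cf t).
Qed.

Lemma le_cintegrable f h : cmeasurableT f -> mu.-integrable setT (EFin \o h) ->
  (forall t, cabs (f t) <= h t) -> cintegrable f.
Proof.
move=> [f1 f2] ih fh; have h0 t : 0 <= h t by apply: le_trans (fh t); exact: cabs_ge0.
split; apply: le_integrable ih => //.
- by apply/measurable_EFinP.
- move=> t _; rewrite /= lee_fin (ger0_norm (h0 t)).
  by apply: le_trans (fh t); exact: normr_Re_le.
- by apply/measurable_EFinP.
- move=> t _; rewrite /= lee_fin (ger0_norm (h0 t)).
  by apply: le_trans (fh t); exact: normr_Im_le.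
Qed.

Lemma circ_integrable_cst (c : R) : mu.-integrable setT (EFin \o cst c).
Proof.
apply/integrableP; split; first exact/measurable_EFinP.
rewrite (_ : (fun _ => _) = cst `|c|%:E)// integral_cst//.
by rewrite [X in (_ * X)%E]circ_measureT mule1 ltry.
Qed.

Lemma circ_bounded_integrable h (B : R) : measurable_fun setT h ->
  (forall t, `|h t| <= B) -> mu.-integrable setT (EFin \o h).
Proof.
move=> mh hB; apply: le_integrable (circ_integrable_cst B) => //.
  exact/measurable_EFinP.
by move=> t _ /=; rewrite lee_fin (le_trans (hB t))// ler_norm.
Qed.

Lemma bounded_cintegrable f (B : R) : cmeasurableT f ->
  (forall t, cabs (f t) <= B) -> cintegrable f.
Proof. by move=> mf fB; apply: (le_cintegrable mf (circ_integrable_cst B)). Qed.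

Lemma cintegrable_measurable f : cintegrable f -> cmeasurableT f.
Proof.
move=> [/integrableP[m1 _] /integrableP[m2 _]].
by split; apply/measurable_EFinP.
Qed.

Lemma cintegrable_cabs f : cintegrable f ->
  mu.-integrable setT (EFin \o (fun t => cabs (f t))).
Proof.
move=> fi; have [i1 i2] := fi.
have := integrableD measurableT (integrable_norm i1) (integrable_norm i2).
have mc : measurable_fun setT (fun t => cabs (f t)).
  exact: cmeasurableT_cabs (cintegrable_measurable fi).
apply: le_integrable => //; first exact/measurable_EFinP.
move=> t _; rewrite /= lee_fin ger0_norm ?cabs_ge0// ger0_norm ?addr_ge0//.
rewrite -[leLHS](ger0_norm (cabs_ge0 _)) -(ler_pXn2r (ltn0Sn 1)) ?nnegrE ?addr_ge0//.
rewrite real_normK ?num_real// -cabs2E /cabs2 sqrrD !real_normK ?num_real//.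
by rewrite addrAC lerDl mulrn_wge0// mulr_ge0.
Qed.

Lemma cintegrableMl f g (B : R) : cintegrable f -> cmeasurableT g ->
  (forall t, cabs (g t) <= B) -> cintegrable (fun t => f t * g t).
Proof.
move=> fi mg gB; have mf := cintegrable_measurable fi.
have B0 : 0 <= B by apply: le_trans (gB 0); exact: cabs_ge0.
apply: (@le_cintegrable _ (fun t => B * cabs (f t))).
- exact: cmeasurableTM.
- have := integrableZl measurableT B (cintegrable_cabs fi).
  by apply: eq_integrable.
- by move=> t; rewrite cabsM mulrC ler_wpM2r// cabs_ge0.
Qed.

Lemma cintegrableD f g : cintegrable f -> cintegrable g ->
  cintegrable (fun t => f t + g t).
Proof.
move=> [f1 f2] [g1 g2]; split.
  have := integrableD measurableT f1 g1.
  by apply: eq_integrable => // t _ /=; rewrite cReD.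
have := integrableD measurableT f2 g2.
by apply: eq_integrable => // t _ /=; rewrite cImD.
Qed.

Lemma cintegrableZ z f : cintegrable f -> cintegrable (fun t => z * f t).
Proof.
move=> fi; rewrite (_ : (fun _ => _) = (fun t => f t * z)); last first.
  by apply/funext => t; rewrite mulrC.
by apply: (@cintegrableMl _ _ (cabs z)) => //; exact: cmeasurableT_cst.
Qed.

Lemma cintD f g : cintegrable f -> cintegrable g ->
  cint (fun t => f t + g t) = cint f + cint g.
Proof.
move=> [f1 f2] [g1 g2]; rewrite /cint; apply/eqP; rewrite eq_complex.
rewrite cReD cImD/= -!RintegralD//; apply/andP; split; apply/eqP;
  by apply: eq_Rintegral => t _ /=; rewrite ?cReD ?cImD.
Qed.

Lemma cintZ z f : cintegrable f -> cint (fun t => z * f t) = z * cint f.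
Proof.
move=> [f1 f2]; rewrite /cint; apply/eqP; rewrite eq_complex.
rewrite cReM cImM/= -!RintegralZl// -RintegralB// -?RintegralD//; last 4 first.
- by have := integrableZl measurableT (Re z) f2; apply: eq_integrable.
- by have := integrableZl measurableT (Im z) f1; apply: eq_integrable.
- by have := integrableZl measurableT (Re z) f1; apply: eq_integrable.
- by have := integrableZl measurableT (Im z) f2; apply: eq_integrable.
by apply/andP; split; apply/eqP; apply: eq_Rintegral => t _ /=;
  rewrite ?cReM ?cImM.
Qed.

Lemma eq_cint f g : f =1 g -> cint f = cint g.
Proof. by move=> /funext ->. Qed.

Lemma cint0 : cint (fun=> 0) = 0 :> R[i].
Proof.
by rewrite /cint /Rintegral; congr (_ +i* _); rewrite integral0_eq.
Qed.

Lemma cint_sum (I : Type) (r : seq I) (F : I -> R -> R[i]) :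
  (forall i, cintegrable (F i)) ->
  cintegrable (fun t => \sum_(i <- r) F i t) /\
  cint (fun t => \sum_(i <- r) F i t) = \sum_(i <- r) cint (F i).
Proof.
move=> Fi; elim: r => [|i r [IH1 IH2]].
  rewrite big_nil (_ : (fun _ => _) = fun=> 0); last first.
    by apply/funext => t; rewrite big_nil.
  split; last exact: cint0.
  apply: (@bounded_cintegrable _ 0); first exact: cmeasurableT_cst.
  by move=> _; rewrite -[0]/(0%:C) cabs_real normr0.
rewrite big_cons (_ : (fun _ => _) = (fun t => F i t + \sum_(i <- r) F i t)).
  by split; [exact: cintegrableD|rewrite cintD// IH2].
by apply/funext => t; rewrite big_cons.
Qed.

Lemma cint_dominated (f_ : nat -> R -> R[i]) f h :
  (forall n, cmeasurableT (f_ n)) -> (forall t, ccvg (f_ ^~ t) (f t)) ->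
  mu.-integrable setT (EFin \o h) -> (forall n t, cabs (f_ n t) <= h t) ->
  ccvg (fun n => cint (f_ n)) (cint f).
Proof.
move=> mf cf ih fh; have mF := cmeasurableT_cvg mf cf.
have aux (p : R[i] -> R) : (forall z, `|p z| <= cabs z) ->
    (forall n, measurable_fun setT (p \o f_ n)) -> measurable_fun setT (p \o f) ->
    (forall t, p (f_ n t) @[n --> \oo] --> p (f t)) ->
    Rintegral mu setT (p \o f_ n) @[n --> \oo] --> Rintegral mu setT (p \o f).
  move=> pc mp mpf cp.
  have [|||||i1 _ c1] := @dominated_convergence _ _ _ mu setT measurableT
    (fun n => EFin \o (p \o f_ n)) (EFin \o (p \o f)) (EFin \o h).
  - by move=> n; apply/measurable_EFinP; exact: mp.
  - exact/measurable_EFinP.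
  - by apply: nearW => t _; apply: cvg_EFin; [exact: nearW|exact: cp].
  - exact: ih.
  - by apply: nearW => t n _; rewrite /= lee_fin; apply: le_trans (pc _) (fh n t).
  apply: fine_cvg; rewrite fineK; first exact: c1.
  exact: integral_fune_fin_num.
split => /=.
- apply: aux; first exact: normr_Re_le.
  + by move=> n; case: (mf n).
  + by case: mF.
  + by move=> t; case: (cf t).
- apply: aux; first exact: normr_Im_le.
  + by move=> n; case: (mf n).
  + by case: mF.
  + by move=> t; case: (cf t).
Qed.

End CircleIntegral.

(** * Fourier coefficients *)

Section Orthogonality.
Context {R : realType}.
Local Open Scope complex_scope.
Local Notation mu := (@circ_measure R).
Local Notation Re := (@complex.Re R).
Local Notation Im := (@complex.Im R).
Implicit Types (w z : R[i]) (psi : R -> R[i]).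

Lemma Rintegral_circ_antiderivative (f F : R -> R) : continuous f ->
  (forall t, 0 <= f t) -> (forall t, is_derive t (1 : R) F (f t)) ->
  Rintegral mu setT f = (pi *+ 2)^-1 * (F (pi *+ 2) - F 0).
Proof.
move=> cf f0 dF; have mf : measurable_fun setT f := continuous_measurable_fun cf.
have pi0 : (0 : R) < pi *+ 2 by rewrite mulrn_wgt0 ?pi_gt0.
have cF : continuous F.
  by move=> t; apply/differentiable_continuous/derivable1_diffP; case: (dF t).
rewrite /Rintegral.
have -> : (\int[mu]_t (f t)%:E = \int[mu]_(t in circD) (f t)%:E)%E.
  rewrite [RHS]integral_mkcond; apply: eq_integral_circ => t Dt.
  by rewrite patchE mem_set.
rewrite (@eq_measure_integral _ _ _ _ (mscale inv2pi (@lebesgue_measure R))); last first.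
  by move=> A mA AD; rewrite /circ_measure/= /mscale/= /mrestr setIidl.
rewrite ge0_integral_mscale//=; last 3 first.
- exact: measurable_circD.
- by apply/measurable_EFinP; apply: measurable_funTS.
- by move=> t _; rewrite lee_fin.
rewrite (continuous_FTC2 pi0 (F := F))//.
- exact: continuous_subspaceT.
- split; first by move=> t _; case: (dF t).
  + by apply: cvg_at_right_filter; exact: cF.
  + by apply: cvg_at_left_filter; exact: cF.
- by move=> t _; rewrite derive1E; case: (dF t).
Qed.

Lemma cos_sin_2pi_int (n : int) :
  cos (n%:~R * (pi *+ 2)) = 1 :> R /\ sin (n%:~R * (pi *+ 2)) = 0 :> R.
Proof.
have nat_case (k : nat) :
    cos (k%:R * (pi *+ 2)) = 1 :> R /\ sin (k%:R * (pi *+ 2)) = 0 :> R.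
  rewrite mulr_natl -[_ *+ k]add0r (periodicn (@cosD2pi R)) (periodicn (@sinD2pi R)).
  by rewrite cos0 sin0.
case: n => k; first exact: nat_case.
by rewrite NegzE mulrNz mulNr cosN sinN; case: (nat_case k.+1) => -> ->; rewrite oppr0.
Qed.

Lemma circ_integrable_bounded1 (f : R -> R) : continuous f ->
  (forall t, `|f t| <= 1) -> mu.-integrable setT (EFin \o f).
Proof.
move=> cf; apply: circ_bounded_integrable; exact: continuous_measurable_fun.
Qed.

(** [Rintegral_circ_antiderivative] needs a nonnegative integrand, so it is applied to [1 + f], with
    antiderivative [t + F t], and the mean of [1] is then removed. *)
Lemma Rintegral_circ_mean0 (f F : R -> R) : continuous f ->
  (forall t, `|f t| <= 1) -> (forall t, is_derive t (1 : R) F (f t)) ->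
  F (pi *+ 2) = F 0 -> Rintegral mu setT f = 0.
Proof.
move=> cf f1 dF FE.
have pi0 : (pi *+ 2 : R) != 0 by rewrite gt_eqF// mulrn_wgt0 ?pi_gt0.
have h : Rintegral mu setT (fun t => 1 + f t) = 1.
  rewrite (@Rintegral_circ_antiderivative _ (fun t => t + F t)).
  - by rewrite FE add0r addrK mulVf.
  - by move=> t; apply: cvgD; [exact: cvg_cst|exact: cf].
  - by move=> t; have := f1 t; rewrite ler_norml => /andP[]; lra.
have i1 := circ_integrable_cst (1 : R).
have i2 := circ_integrable_bounded1 cf f1.
move: h; rewrite (RintegralD measurableT i1 i2).
rewrite Rintegral_cst// [X in fine X]circ_measureT mulr1 => h.
by apply: (addrI 1); rewrite addr0.
Qed.

Lemma normr_cos_le1 (x : R) : `|cos x| <= 1.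
Proof. by rewrite ler_norml cos_geN1 cos_le1. Qed.

Lemma normr_sin_le1 (x : R) : `|sin x| <= 1.
Proof. by rewrite ler_norml sin_geN1 sin_le1. Qed.

Lemma cint_cst z : cint (fun=> z) = z.
Proof.
case: z => a b; rewrite /cint/= !Rintegral_cst// [X in fine X]circ_measureT.
by rewrite !mulr1.
Qed.

Lemma cint_expi (n : int) : cint (fun t => expi (n%:~R * t)) = (n == 0)%:R :> R[i].
Proof.
have [->|n0] := eqVneq n 0.
  rewrite -[RHS](cint_cst 1); apply: eq_cint => t.
  by rewrite mul0r /expi cos0 sin0.
have a0 : n%:~R != 0 :> R by rewrite intr_eq0.
set a : R := n%:~R in a0 *.
have [c1 s0] := cos_sin_2pi_int n; rewrite -/a in c1 s0.
have da t : is_derive t (1 : R) (fun t => a * t) a.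
  by apply: is_derive_eq; rewrite /GRing.scale/= mulr1.
rewrite /cint; apply/eqP; rewrite eq_complex/=; apply/andP; split; apply/eqP.
- apply: (@Rintegral_circ_mean0 _ (fun t => a^-1 * sin (a * t))).
  + move=> t; apply: continuous_comp; last exact: continuous_cos.
    by apply: cvgM; [exact: cvg_cst|exact: cvg_id].
  + by move=> t; exact: normr_cos_le1.
  + move=> t.
    have dt := da t.
    have ds := @is_derive1_comp R sin (fun t => a * t) t _ _ (is_derive_sin (a * t)) dt.
    apply: is_derive_eq; rewrite /GRing.scale/=.
    by field.
  + by rewrite s0 !mulr0 sin0 mulr0.
- apply: (@Rintegral_circ_mean0 _ (fun t => - a^-1 * cos (a * t))).
  + move=> t; apply: continuous_comp; last exact: continuous_sin.
    by apply: cvgM; [exact: cvg_cst|exact: cvg_id].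
  + by move=> t; exact: normr_sin_le1.
  + move=> t.
    have dt := da t.
    have ds := @is_derive1_comp R cos (fun t => a * t) t _ _ (is_derive_cos (a * t)) dt.
    apply: is_derive_eq; rewrite /GRing.scale/=.
    by field.
  + by rewrite c1 !mulr0 cos0.
Qed.

Lemma cabs_expi (x : R) : cabs (expi x) = 1.
Proof. by rewrite cabsE /cabs2/= cos2Dsin2 sqrtr1. Qed.

Lemma expiD (x y : R) : expi (x + y) = expi x * expi y.
Proof.
by rewrite /expi cosD sinD; apply/eqP; rewrite eq_complex/= eqxx/= addrC.
Qed.

Lemma expi0 : expi 0 = 1 :> R[i].
Proof. by rewrite /expi cos0 sin0. Qed.

Lemma cconj_expi (x : R) : cconj (expi x) = expi (- x).
Proof. by rewrite /cconj /expi/= cosN sinN. Qed.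

Lemma expiX (x : R) n : expi x ^+ n = expi (n%:R * x).
Proof.
elim: n => [|n IH]; first by rewrite mul0r expi0 expr0.
by rewrite exprS IH -expiD -nat1r mulrDl mul1r.
Qed.

Lemma cconjM z w : cconj (z * w) = cconj z * cconj w.
Proof. by rewrite !cconjE rmorphM. Qed.

Lemma cconjX z n : cconj (z ^+ n) = cconj z ^+ n.
Proof. by rewrite !cconjE rmorphXn. Qed.

Lemma cconj_sum (I : Type) (r : seq I) (F : I -> R[i]) :
  cconj (\sum_(i <- r) F i) = \sum_(i <- r) cconj (F i).
Proof.
apply: (big_morph (@cconj R)) => [x y|]; first by rewrite !cconjE rmorphD.
by rewrite cconjE rmorph0.
Qed.

Lemma cconjK z : cconj (cconj z) = z.
Proof. by case: z => a b; rewrite /cconj/= opprK. Qed.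

Lemma cconj_real (x : R) : cconj x%:C = x%:C.
Proof. by rewrite /cconj/= oppr0. Qed.

Lemma mulr_cconj w : cconj w * w = (cabs2 w)%:C.
Proof.
case: w => a b; rewrite /cabs2; apply/eqP; rewrite eq_complex/=.
by apply/andP; split; apply/eqP; ring.
Qed.

(* [szego w t] is convertible to [(1 - disk_pt w t)^-1]. *)
Definition disk_pt w (t : R) : R[i] := cconj w * expi t.

Lemma cabs_disk_pt w t : cabs (disk_pt w t) = cabs w.
Proof. by rewrite cabsM cabs_conj cabs_expi mulr1. Qed.

Lemma binom_part_measurable s w n :
  cmeasurableT (fun t => binom_part s (disk_pt w t) n).
Proof.
rewrite /binom_part; elim: n => [|n IH].
  rewrite (_ : (fun _ => _) = fun=> 0); first exact: cmeasurableT_cst.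
  by apply/funext => t; rewrite big_geq.
rewrite (_ : (fun _ => _) = (fun t =>
    \sum_(0 <= k < n) (binom_coef s k)%:C * disk_pt w t ^+ k +
    (binom_coef s n)%:C * cconj w ^+ n * expi (n%:R * t))).
  apply: cmeasurableTD => //; apply: cmeasurableTM; first exact: cmeasurableT_cst.
  exact: cmeasurableT_expi.
by apply/funext => t; rewrite big_nat_recr//= exprMn expiX mulrA.
Qed.

Lemma binom_fun_measurable s w : cabs w < 1 ->
  cmeasurableT (fun t => binom_fun s (disk_pt w t)).
Proof.
move=> w1; apply: (@cmeasurableT_cvg _ (fun n t => binom_part s (disk_pt w t) n)).
  by move=> n; exact: binom_part_measurable.
by move=> t; apply: binom_part_cvg; rewrite cabs_disk_pt.
Qed.

Lemma binom_part_bound_disk s w : cabs w < 1 ->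
  exists B, forall t n, cabs (binom_part s (disk_pt w t) n) <= B.
Proof.
move=> w1; have [B hB] := binom_part_bound s (cabs_ge0 w) w1.
by exists B => t n; apply: hB; rewrite cabs_disk_pt.
Qed.

Lemma binom_fun_bound s w : cabs w < 1 ->
  exists B, forall t, cabs (binom_fun s (disk_pt w t)) <= B.
Proof.
move=> w1; have [B hB] := binom_part_bound_disk s w1; exists B => t.
have [c1 c2] : ccvg (binom_part s (disk_pt w t)) (binom_fun s (disk_pt w t)).
  by apply: binom_part_cvg; rewrite cabs_disk_pt.
have B0 : 0 <= B by apply: le_trans (hB t 0); exact: cabs_ge0.
rewrite -(ler_pXn2r (ltn0Sn 1)) ?nnegrE ?cabs_ge0// -cabs2E.
have cc : cabs2 (binom_part s (disk_pt w t) n) @[n --> \oo] -->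
    cabs2 (binom_fun s (disk_pt w t)).
  by rewrite /cabs2; apply: cvgD; rewrite expr2;
    under eq_fun do rewrite expr2; apply: cvgM.
rewrite -(cvg_lim _ cc)//; apply: limr_le; first by apply/cvg_ex; eexists; exact: cc.
apply: nearW => n; rewrite cabs2E ler_pXn2r ?nnegrE ?cabs_ge0//.
Qed.

Lemma cintegrable_binom_fun s w : cabs w < 1 ->
  cintegrable (fun t => binom_fun s (disk_pt w t)).
Proof.
move=> w1; have [B hB] := binom_fun_bound s w1.
exact: bounded_cintegrable (binom_fun_measurable s w1) hB.
Qed.

Lemma cmeasurableT_expiN (a : R) : cmeasurableT (fun t => expi (- (a * t))).
Proof.
rewrite (_ : (fun _ => _) = (fun t : R => expi ((- a) * t))).
  exact: cmeasurableT_expi.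
by apply/funext => t; rewrite mulNr.
Qed.

(** The coefficient of index [n] of the partial sums is constant from [N = n+1] on, and dominated
    convergence carries it to the sum. *)
Lemma fourier_binom_fun s w (n : nat) : cabs w < 1 ->
  fourier (fun t => binom_fun s (disk_pt w t)) n%:Z =
  (binom_coef s n)%:C * cconj w ^+ n.
Proof.
move=> w1; have [B hB] := binom_part_bound_disk s w1.
pose f_ N t := binom_part s (disk_pt w t) N * expi (- (n%:R * t)).
have mE := @cmeasurableT_expiN n%:R.
apply: (@ccvg_unique _ (fun N => cint (f_ N))).
  apply: (@cint_dominated _ _ _ (cst B)) => //.
  - by move=> N; apply: cmeasurableTM => //; exact: binom_part_measurable.
  - move=> t; apply: ccvgM; last exact: ccvg_cst.
    by apply: binom_part_cvg; rewrite cabs_disk_pt.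
  - exact: circ_integrable_cst.
  - by move=> N t; rewrite /f_ cabsM cabs_expi mulr1.
have val N : (n < N)%N -> cint (f_ N) = (binom_coef s n)%:C * cconj w ^+ n.
  move=> nN; pose F (k : nat) t := (binom_coef s k)%:C * cconj w ^+ k *
    expi ((k%:Z - n%:Z)%:~R * t).
  have eF k : cintegrable (fun t => expi ((k%:Z - n%:Z)%:~R * t) : R[i]).
    apply: (@bounded_cintegrable _ _ 1); first exact: cmeasurableT_expi.
    by move=> t; rewrite cabs_expi.
  have iF k : cintegrable (F k) by apply: cintegrableZ.
  rewrite (@eq_cint _ _ (fun t => \sum_(k <- index_iota 0 N) F k t)); last first.
    move=> t; rewrite /f_ /binom_part mulr_suml; apply: eq_bigr => k _.
    rewrite /F exprMn expiX -!mulrA -expiD; congr (_ * (_ * expi _)).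
    by rewrite intrD mulrDl mulrNz mulNr.
  rewrite (cint_sum _ iF).2.
  rewrite (eq_bigr (fun k : nat =>
    if k == n then (binom_coef s k)%:C * cconj w ^+ k else 0)); last first.
    move=> k _; rewrite cintZ// cint_expi subr_eq0 eqz_nat.
    by case: eqP => _; rewrite ?mulr1 ?mulr0.
  rewrite -big_mkcond/= big_nat1_eq.
  by rewrite leq0n nN.
have e : \forall N \near \oo, cint (f_ N) = (binom_coef s n)%:C * cconj w ^+ n.
  by near=> N; apply: val; near: N; exact: nbhs_infty_gt.
by split; apply: cvg_near_cst; apply: filterS e => N; rewrite /comp => ->.
Unshelve. all: by end_near. Qed.

(** The conjugate factor has only nonpositive frequencies, so only coefficients of [psi] of index at
    least [k] enter. Three uses follow: [psi = binom_fun s] with [k = 0] is Parseval,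
    [psi = binom_fun 1] gives the coefficients of the extremal function, and a general [psi] with
    [k = 0] gives the dual pairing. *)
Lemma cint_conj_binom_fun s w psi (k : nat) : cabs w < 1 -> cintegrable psi ->
  ccvg (fun N => \sum_(0 <= j < N)
          (binom_coef s j)%:C * w ^+ j * fourier psi (k + j)%N%:Z)
    (cint (fun t => psi t * cconj (binom_fun s (disk_pt w t)) *
                    expi (- (k%:R * t)))).
Proof.
move=> w1 ipsi; have [B hB] := binom_part_bound_disk s w1.
have mpsi := cintegrable_measurable ipsi.
pose f_ N t := psi t * cconj (binom_part s (disk_pt w t) N) * expi (- (k%:R * t)).
rewrite (_ : (fun N => \sum_(0 <= j < N) _) = fun N => cint (f_ N)); last first.
  apply/funext => N.
  pose F (j : nat) t := (binom_coef s j)%:C * w ^+ j *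
    (psi t * expi (- ((k + j)%N%:Z%:~R * t))).
  have iE j : cintegrable (fun t => psi t * expi (- ((k + j)%N%:Z%:~R * t))).
    apply: (@cintegrableMl _ _ _ 1) => //; first exact: cmeasurableT_expiN.
    by move=> t; rewrite cabs_expi.
  have iF j : cintegrable (F j) by apply: cintegrableZ.
  rewrite (@eq_cint _ (f_ N) (fun t => \sum_(j <- index_iota 0 N) F j t)).
    by rewrite (cint_sum _ iF).2; apply: eq_bigr => j _; rewrite cintZ.
  move=> t; rewrite /f_ /binom_part cconj_sum mulr_sumr mulr_suml.
  apply: eq_bigr => j _; rewrite cconjM cconj_real cconjX /disk_pt cconjM.
  rewrite cconjK cconj_expi exprMn expiX /F mulrN.
  have -> : - ((k + j)%N%:Z%:~R * t) = - (j%:R * t) + - (k%:R * t).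
    by rewrite -opprD -mulrDl -natrD addnC.
  by rewrite expiD; ring.
apply: (@cint_dominated _ _ _ (fun t => B * cabs (psi t))) => //.
- move=> N; apply: cmeasurableTM; last exact: cmeasurableT_expiN.
  apply: cmeasurableTM => //.
  by apply: cmeasurableT_conj; exact: binom_part_measurable.
- move=> t; apply: ccvgM; last exact: ccvg_cst.
  apply: ccvgM; first exact: ccvg_cst.
  by apply: ccvg_conj; apply: binom_part_cvg; rewrite cabs_disk_pt.
- have := integrableZl measurableT B (cintegrable_cabs ipsi).
  by apply: eq_integrable.
- move=> N t; rewrite /f_ !cabsM cabs_expi mulr1 cabs_conj mulrC ler_wpM2r//.
  exact: cabs_ge0.
Qed.

End Orthogonality.

(** * Means of the Szego kernel *)

Section SzegoMeans.
Context {R : realType}.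
Local Open Scope complex_scope.
Local Notation mu := (@circ_measure R).
Local Notation Re := (@complex.Re R).
Local Notation Im := (@complex.Im R).
Implicit Types (w z : R[i]) (s p : R).

Definition dist2 w t : R := cabs2 (1 - disk_pt w t).

Lemma dist2_gt0 w t : cabs w < 1 -> 0 < dist2 w t.
Proof.
move=> w1; rewrite lt_def cabs2_ge0 andbT /dist2 cabs2E sqrf_eq0.
apply/eqP => /ComplexField.Normc.eq0_normc /eqP; rewrite subr_eq0 => /eqP h.
by move: w1; rewrite -(cabs_disk_pt w t) -h cabs1 ltxx.
Qed.

(** All real powers of [dist2], of either sign, thereby inherit measurability and boundedness from
    binomial sums. *)
Lemma dist2_powE s w t : cabs w < 1 ->
  dist2 w t `^ s = cabs2 (binom_fun (- s) (disk_pt w t)).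
Proof. by move=> w1; rewrite cabs2_binom_fun ?cabs_disk_pt// opprK. Qed.

Lemma cabs_pow_dist2 s w t : cabs w < 1 ->
  cabs (binom_fun s (disk_pt w t)) = dist2 w t `^ (- s / 2).
Proof.
move=> w1; rewrite cabsE -powR12_sqrt ?cabs2_ge0//.
by rewrite cabs2_binom_fun ?cabs_disk_pt// -powRrM.
Qed.

Lemma cabs_szego w t : cabs w < 1 -> cabs (szego w t) = dist2 w t `^ (- 1 / 2).
Proof.
move=> w1; rewrite /szego cabsV cabsE -/(disk_pt w t) -/(dist2 w t).
by rewrite -powR12_sqrt ?cabs2_ge0// -powRN mulN1r.
Qed.

Lemma measurable_dist2_pow s w : cabs w < 1 ->
  measurable_fun setT (fun t => dist2 w t `^ s).
Proof.
move=> w1; rewrite (_ : (fun _ => _) =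
    (fun t => cabs2 (binom_fun (- s) (disk_pt w t)))).
  by apply: cmeasurableT_cabs2; exact: binom_fun_measurable.
by apply/funext => t; rewrite dist2_powE.
Qed.

Lemma integrable_dist2_pow s w : cabs w < 1 ->
  mu.-integrable setT (EFin \o (fun t => dist2 w t `^ s)).
Proof.
move=> w1; have [B hB] := binom_fun_bound (- s) w1.
apply: (@circ_bounded_integrable _ _ (B ^+ 2)).
  exact: measurable_dist2_pow.
move=> t; rewrite ger0_norm ?powR_ge0// dist2_powE// cabs2E.
by rewrite ler_pXn2r ?nnegrE ?cabs_ge0// (le_trans _ (hB t))// cabs_ge0.
Qed.

(** For [s > 0] this is [||k_w||_p^p] with [p = 2 s]. Negative [s] serves in the computation of the
    logarithmic mean. *)
Definition szego_mean s w : R := Rintegral mu setT (fun t => dist2 w t `^ (- s)).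

Lemma szego_mean_ge0 s w : 0 <= szego_mean s w.
Proof. by apply: Rintegral_ge0 => t _; exact: powR_ge0. Qed.

Lemma szego_mean_series s w : cabs w < 1 ->
  series (fun m => binom_coef s m ^+ 2 * cabs2 w ^+ m) @ \oo --> szego_mean s w.
Proof.
move=> w1; have [h _] := cint_conj_binom_fun s 0 w1 (cintegrable_binom_fun s w1).
move: h; rewrite [X in _ --> X](_ : _ = szego_mean s w); last first.
  rewrite /szego_mean /cint [LHS]/=; apply: eq_Rintegral => t _.
  rewrite /comp mul0r oppr0 expi0 mulr1 mulrC mulr_cconj/=.
  by rewrite cabs2_binom_fun ?cabs_disk_pt.
rewrite [X in X @ _ --> _ -> _](_ : _ =
  series (fun m => binom_coef s m ^+ 2 * cabs2 w ^+ m))//.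
apply/funext => N; rewrite /comp Re_sum /series/=; apply: eq_bigr => m _.
rewrite add0n fourier_binom_fun//.
rewrite (_ : _ * _ = (binom_coef s m ^+ 2 * cabs2 w ^+ m)%:C)//.
rewrite rmorphM !rmorphXn/= -mulr_cconj exprMn; ring.
Qed.

Lemma szego_mean1 w : cabs w < 1 -> szego_mean 1 w = (1 - cabs2 w)^-1.
Proof.
move=> w1; have r0 := cabs2_ge0 w.
have r1 : cabs2 w < 1 by rewrite cabs2E expr_lt1 ?cabs_ge0.
have h := @szego_mean_series 1 w w1; have := @binom_series R 1 _ r0 r1.
rewrite powR_inv1 ?subr_ge0 ?ltW// => h2.
apply: cvg_unique h _ => //; move: h2; rewrite /pseries.
by rewrite (_ : (fun n => _) = (fun m => binom_coef 1 m ^+ 2 * cabs2 w ^+ m))//;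
  apply/funext => m; rewrite binom_coef_s1 expr1n.
Qed.

Section Bounds.
Variables (s : R) (w : R[i]).
Hypothesis w1 : cabs w < 1.
Let r := cabs2 w.
Let r0 : 0 <= r := cabs2_ge0 w.
Let r1 : r < 1. Proof. by rewrite /r cabs2E expr_lt1 ?cabs_ge0. Qed.
Let a m := binom_coef s m ^+ 2 * r ^+ m.
Let b m := binom_coef (s ^+ 2) m * r ^+ m.
Let ca : series a @ \oo --> szego_mean s w := @szego_mean_series s w w1.
Let cb : series b @ \oo --> (1 - r) `^ (- s ^+ 2) := @binom_series R (s ^+ 2) _ r0 r1.
Let ab m : a m <= b m.
Proof. by rewrite ler_wpM2r ?exprn_ge0// binom_coef_sqr_le. Qed.

Lemma szego_mean_le : szego_mean s w <= (1 - r) `^ (- s ^+ 2).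
Proof.
apply: (ler_cvg_to ca cb); apply: nearW => n.
by apply: ler_sum => m _; exact: ab.
Qed.

Lemma szego_mean_lt : s != 0 -> s != 1 -> 0 < r ->
  szego_mean s w < (1 - r) `^ (- s ^+ 2).
Proof.
move=> s0 s1 rp; have ab2 : a 2 < b 2.
  by rewrite ltr_pM2r ?exprn_gt0// binom_coef2_sqr_lt.
(* Strict inequality of terms does not survive the limit, but the fixed gap at index [2] does: it is
   present in every partial sum of length at least [3]. *)
suff : szego_mean s w + (b 2 - a 2) <= (1 - r) `^ (- s ^+ 2).
  by move: ab2; rewrite -subr_gt0 => ?; lra.
have ca' : (fun n => series a n + (b 2 - a 2)) @ \oo -->
    szego_mean s w + (b 2 - a 2).
  by apply: cvgD; [exact: ca|exact: cvg_cst].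
apply: (ler_cvg_to ca' cb); exists 3%N => // n /= n3.
rewrite /series /= -lerBrDl -sumrB.
rewrite (bigD1_seq 2%N) ?iota_uniq//=; last by rewrite mem_index_iota.
by rewrite lerDl sumr_ge0// => m _; rewrite subr_ge0.
Qed.

(** The terms of the Parseval series are nonnegative and the first two are kept, so the bound is
    exact to first order in [r], as the necessity of [p <= 4/q^*] requires. *)
Lemma szego_mean_ge : 1 + s ^+ 2 * r <= szego_mean s w.
Proof.
rewrite -(cvg_lim _ ca)//; apply: limr_ge; first by apply/cvg_ex; eexists; exact: ca.
exists 2%N => // n /= n2; rewrite /series/= -(subnK n2) addn2.
rewrite big_nat_recl// big_nat_recl//= addrA /a.
rewrite /binom_coef !big_ord_recl !big_ord0 /= !expr1 !expr0 addr0 !mulr1.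
rewrite divr1 expr1n lerDl.
by apply: sumr_ge0 => m _; rewrite mulr_ge0 ?sqr_ge0 ?exprn_ge0.
Qed.

End Bounds.

Lemma Lpnorm_dist2_pow (f : R -> R[i]) (C e p : R) w : cabs w < 1 ->
  0 <= C -> 0 < p -> (forall t, cabs (f t) = C * dist2 w t `^ e) ->
  Lpnorm p%:E f = (C * szego_mean (- (e * p)) w `^ p^-1)%:E.
Proof.
move=> w1 C0 p0 fE; rewrite /Lpnorm unlock.
have -> : (\int[mu]_t `|(cabs (f t))%:E| `^ p =
    (C `^ p * szego_mean (- (e * p)) w)%:E)%E.
  rewrite /szego_mean -RintegralZl//; last exact: integrable_dist2_pow.
  rewrite /Rintegral fineK; last first.
    apply: integral_fune_fin_num => //.
    have := integrableZl measurableT (C `^ p) (integrable_dist2_pow (- - (e * p)) w1).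
    by apply: eq_integrable.
  apply: eq_integral => t _.
  rewrite /= ger0_norm ?cabs_ge0// fE powRM ?powR_ge0//.
  by rewrite -powRrM opprK.
rewrite poweR_EFin powRM ?powR_ge0 ?szego_mean_ge0// -powRrM.
by rewrite divff ?gt_eqF// powRr1.
Qed.

Lemma pnorm_szego p w : cabs w < 1 -> 0 < p ->
  pnorm p (szego w) = (szego_mean (p / 2) w `^ p^-1)%:E.
Proof.
move=> w1 p0; rewrite /pnorm gt_eqF//.
rewrite (@Lpnorm_dist2_pow _ 1 (- 1 / 2) p w)//.
  by rewrite mul1r; congr (szego_mean _ _ `^ _)%:E; field.
by move=> t; rewrite mul1r cabs_szego.
Qed.

(** From [ln x < x] at both [d] and [1/d] one gets [|ln d| <= d + 1/d], a sum of two integrable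
    powers. *)
Lemma integrable_ln_dist2 w : cabs w < 1 ->
  mu.-integrable setT (EFin \o (fun t => ln (dist2 w t))).
Proof.
move=> w1; have i1 := integrable_dist2_pow 1 w1.
have i2 := integrable_dist2_pow (-1) w1.
have := integrableD measurableT i1 i2; apply: le_integrable => //.
  apply/measurable_EFinP; apply: (measurableT_comp (@measurable_ln R)).
  have := measurable_dist2_pow 1 w1.
  by rewrite (_ : (fun _ => _) = dist2 w)//; apply/funext => t;
    rewrite powRr1// cabs2_ge0.
move=> t _; have d0 := dist2_gt0 t w1.
rewrite /= lee_fin [leRHS]ger0_norm ?addr_ge0 ?powR_ge0//.
rewrite powRr1 ?(ltW d0)// powR_inv1 ?(ltW d0)//.
have dv : 0 < (dist2 w t)^-1 by rewrite invr_gt0.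
have := ln_sublinear d0; have := ln_sublinear dv; rewrite lnV ?posrE// => h1 h2.
by rewrite ler_norml; apply/andP; split; lra.
Qed.

(* [e^x >= 1 + x] bounds [- s K], [K] the mean of [ln (dist2 w)], by
   [szego_mean s w - 1 = O(s^2)] for both signs of [s], so [K = 0]. *)
Lemma Rintegral_ln_dist2 w : cabs w < 1 ->
  Rintegral mu setT (fun t => ln (dist2 w t)) = 0.
Proof.
move=> w1; set K := Rintegral _ _ _.
have iln := integrable_ln_dist2 w1.
pose L := - ln (1 - cabs2 w).
have r0 := cabs2_ge0 w.
have r1 : cabs2 w < 1 by rewrite cabs2E expr_lt1 ?cabs_ge0.
have L0 : 0 <= L by rewrite oppr_ge0 ln_le0// lerBlDr lerDl.
have low s : 1 - s * K <= szego_mean s w.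
  have iK := integrableZl measurableT (- s) iln.
  have i1 := circ_integrable_cst (1 : R).
  have -> : 1 - s * K = Rintegral mu setT (fun t => 1 + - s * ln (dist2 w t)).
    rewrite (RintegralD measurableT i1 iK) Rintegral_cst// [X in fine X]circ_measureT.
    by rewrite /= mulr1 RintegralZl// mulNr.
  apply: le_Rintegral => //.
  - have := integrableD measurableT i1 iK; exact: eq_integrable.
  - exact: integrable_dist2_pow.
  - move=> t _; rewrite /powR gt_eqF ?dist2_gt0//; exact: expR_ge1Dx.
have up s : szego_mean s w <= expR (s ^+ 2 * L).
  apply: le_trans (szego_mean_le s w1) _.
  by rewrite /powR gt_eqF ?subr_gt0// /L mulrN mulNr.
(* Inverting [e^(-x) >= 1 - x] gives [e^x <= 1/(1 - x)], and this is at most [1 + 2 x] exactly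
   because [x <= 1/2]. *)
have expb (x : R) : 0 <= x -> x <= 1 / 2 -> expR x <= 1 + 2 * x.
  move=> x0 x2; have := expR_ge1Dx (- x); rewrite expRN => h.
  have : (expR x) <= (1 - x)^-1.
    rewrite -[leLHS]invrK lef_pV2 ?posrE ?invr_gt0 ?expR_gt0//.
    by rewrite subr_gt0; lra.
  move=> /le_trans; apply; rewrite -[leLHS]div1r ler_pdivrMr ?subr_gt0; last lra.
  nra.
have key s : s ^+ 2 * L <= 1 / 2 -> - (s * K) <= 2 * (s ^+ 2 * L).
  move=> h; have x0 : 0 <= s ^+ 2 * L by rewrite mulr_ge0 ?sqr_ge0.
  by have := low s; have := up s; have := expb _ x0 h; lra.
have small s : 0 < s -> s ^+ 2 * L <= 1 / 2 -> `|K| <= 2 * s * L.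
  move=> s0 h; have h1 := key s h.
  have h2 : s * K <= 2 * (s ^+ 2 * L).
    by have := key (- s); rewrite sqrrN mulNr opprK; exact.
  rewrite ler_norml; apply/andP; split; rewrite -(ler_pM2l s0).
    by rewrite mulrN; lra.
  lra.
apply/eqP; rewrite -normr_le0; apply/ler_addgt0Pl => e e0; rewrite addr0.
(* Two demands are met at once: [s (2 L + 1) <= e] yields [2 s L <= e], and [s (2 L + 1) <= 1]
   yields [s^2 L <= s L <= 1/2]. The added [1] covers [L = 0]. *)
pose s := Num.min (e / (2 * L + 1)) (1 / (2 * L + 1)).
have Lp : 0 < 2 * L + 1 by lra.
have s0 : 0 < s by rewrite lt_min !divr_gt0.
have s1 : s * (2 * L + 1) <= e by rewrite -ler_pdivlMr// ge_min lexx.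
have s2 : s * (2 * L + 1) <= 1 by rewrite -ler_pdivlMr// ge_min lexx orbT.
apply: le_trans (small s s0 _) _; last nra.
have : s <= 1 by nra.
nra.
Qed.

Lemma L0norm_szego w : cabs w < 1 -> L0norm (szego w) = 1%E.
Proof.
move=> w1; rewrite /L0norm.
have -> : (\int[mu]_t (ln (cabs (szego w t)))%:E = 0)%E.
  have h : Rintegral mu setT (fun t => (- 1 / 2) * ln (dist2 w t)) = 0.
    by rewrite RintegralZl// ?Rintegral_ln_dist2 ?mulr0//; exact: integrable_ln_dist2.
  have fE t : ln (cabs (szego w t)) = (- 1 / 2) * ln (dist2 w t).
    by rewrite cabs_szego// ln_powR.
  transitivity (\int[mu]_t ((- 1 / 2) * ln (dist2 w t))%:E)%E.
    by apply: eq_integral => t _; rewrite fE.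
  rewrite -[LHS]fineK ?[X in X%:E]h//.
  apply: integral_fune_fin_num => //.
  have := integrableZl measurableT (- 1 / 2) (integrable_ln_dist2 w1).
  exact: eq_integrable.
by rewrite /= expR0.
Qed.

End SzegoMeans.

(** * The extremal problem *)

Section MinimalNorm.
Context {R : realType}.
Local Open Scope complex_scope.
Local Notation mu := (@circ_measure R).
Local Notation Re := (@complex.Re R).
Local Notation Im := (@complex.Im R).
Implicit Types (w : R[i]) (psi : R -> R[i]) (q : \bar R).

Lemma cabs2_lt1 w : cabs w < 1 -> cabs2 w < 1.
Proof. by move=> w1; rewrite cabs2E expr_lt1 ?cabs_ge0. Qed.

Lemma circ_measureT_gt0 : (0 < mu setT)%E.
Proof. by have /= -> := @circ_measureT R; rewrite lte01. Qed.

Lemma Lpnorm_infty psi :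
  Lpnorm +oo psi = ess_sup mu (abse \o (fun t => (cabs (psi t))%:E)).
Proof. by rewrite /Lpnorm unlock ifT//; exact: circ_measureT_gt0. Qed.

Definition min_norm q w : R := (1 - cabs2 w) `^ (- (four_over_conj q / 4)).

(** For [q = 1] this is the Poisson kernel [(1 - r) |1 - conj w z|^(-2)], for [q = 2] it is [k_w]
    itself, and for [q = oo] it has constant modulus [1/(1 - r)]. *)
Definition extremal q w (t : R) : R[i] :=
  let s := four_over_conj q / 2 in
  ((1 - cabs2 w) `^ (1 - s))%:C *
  (binom_fun 1 (disk_pt w t) * cconj (binom_fun (1 - s) (disk_pt w t))).

Lemma extremal_measurable q w : cabs w < 1 -> cmeasurableT (extremal q w).
Proof.
move=> w1; apply: cmeasurableTM; first exact: cmeasurableT_cst.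
apply: cmeasurableTM; first exact: binom_fun_measurable.
by apply: cmeasurableT_conj; exact: binom_fun_measurable.
Qed.

Lemma cabs_extremal q w t : cabs w < 1 -> cabs (extremal q w t) =
  (1 - cabs2 w) `^ (1 - four_over_conj q / 2) *
  dist2 w t `^ (four_over_conj q / 4 - 1).
Proof.
move=> w1; rewrite /extremal cabsM cabs_real ger0_norm ?powR_ge0//.
rewrite cabsM cabs_conj !cabs_pow_dist2// -powRD; last first.
  by rewrite (gt_eqF (dist2_gt0 t w1)) implybT.
by congr (_ * _ `^ _); field.
Qed.

(** The coefficients of [binom_fun 1] are geometric, so lowering frequencies by the conjugate factor
    multiplies every coefficient of index [n >= 0] by the same sum [(1 - r)^(s-1)], which the
    leading constant cancels. *)
Lemma extremal_fourier q w : cabs w < 1 -> Pplus_is_kernel (extremal q w) w.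
Proof.
move=> w1 n; rewrite /fourier /extremal; set s := _ / 2.
set c := (1 - _) `^ _.
have r0 := cabs2_ge0 w; have r1 := cabs2_lt1 w1.
have r1p : 0 < 1 - cabs2 w by rewrite subr_gt0.
have i1 := cintegrable_binom_fun 1 w1.
pose g t := binom_fun 1 (disk_pt w t) * cconj (binom_fun (1 - s) (disk_pt w t)) *
  expi (- (n%:R * t)).
have ig : cintegrable g.
  have [B hB] := binom_fun_bound (1 - s) w1.
  apply: (@cintegrableMl _ _ _ 1); last by move=> t; rewrite cabs_expi.
    apply: (@cintegrableMl _ _ _ B) => //.
      by apply: cmeasurableT_conj; exact: binom_fun_measurable.
    by move=> t; rewrite cabs_conj.
  exact: cmeasurableT_expiN.
rewrite (@eq_cint _ _ (fun t => c%:C * g t)); last first.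
  by move=> t; rewrite /g -!mulrA.
rewrite cintZ//.
have h := cint_conj_binom_fun (1 - s) n w1 i1.
have -> : cint g = cconj w ^+ n * ((1 - cabs2 w) `^ (- (1 - s)))%:C.
  apply: ccvg_unique h _.
  have hs := @binom_series R (1 - s) _ r0 r1.
  rewrite (_ : (fun N => _) = (fun N => cconj w ^+ n *
      (pseries (binom_coef (1 - s)) (cabs2 w) N)%:C)); last first.
    apply/funext => N; rewrite /pseries /series/= rmorph_sum mulr_sumr.
    apply: eq_bigr => j _; rewrite fourier_binom_fun// binom_coef_s1 mul1r.
    by rewrite rmorphM rmorphXn/= -mulr_cconj exprMn exprD; ring.
  apply: ccvgM; first exact: ccvg_cst.
  by split; [exact: hs|exact: cvg_cst].
rewrite mulrCA -rmorphM -powRD; last by rewrite (gt_eqF r1p) implybT.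
by rewrite subrr powRr0 mulr1.
Qed.

(** For finite [q] the power [q] of the modulus is a multiple of [dist2^(-1)], whose mean is
    [szego_mean1]; for [q = oo] the exponent of [dist2] is [0]. *)
Lemma Lpnorm_extremal q w : (1 <= q)%E -> cabs w < 1 ->
  Lpnorm q (extremal q w) = (min_norm q w)%:E.
Proof.
move=> q1 w1; have r1 : 0 < 1 - cabs2 w by rewrite subr_gt0 cabs2_lt1.
have := @cabs_extremal q w; case: q q1 => [q| |]// q1 cE.
- rewrite lee_fin in q1; have q0 : 0 < q by exact: lt_le_trans q1.
  have cE' t : cabs (extremal q%:E w t) =
      (1 - cabs2 w) `^ (1 - four_over_conj q%:E / 2) * dist2 w t `^ (- q^-1).
    by rewrite cE//=; congr (_ * _ `^ _); field; rewrite gt_eqF.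
  rewrite (Lpnorm_dist2_pow w1 (powR_ge0 _ _) q0 cE').
  rewrite mulNr opprK mulVf ?gt_eqF// szego_mean1//.
  rewrite -(powR_inv1 (ltW r1)) -powRrM -powRD; last by rewrite (gt_eqF r1) implybT.
  by rewrite /min_norm/=; congr (_ `^ _)%:E; field; rewrite gt_eqF.
- rewrite Lpnorm_infty; apply: ess_sup_ae_cst; first exact: circ_measureT_gt0.
  apply: nearW => t; rewrite -[LHS]/(`|cabs (extremal +oo w t)|%:E) cE//.
  rewrite ger0_norm; last by rewrite mulr_ge0 ?powR_ge0.
  by rewrite /min_norm/= divff// subrr powRr0 mulr1; congr (_ `^ _)%:E; lra.
Qed.

Lemma extremal_inLq q w : (1 <= q)%E -> cabs w < 1 -> inLq q (extremal q w).
Proof.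
move=> q1 w1; split; last by rewrite Lpnorm_extremal// ltry.
have [m1 m2] := extremal_measurable q w1.
by split; apply: measurable_funTS.
Qed.

(** The weight is the modulus of [binom_fun s], with conjugate norm [min_norm q w]. At the ends
    Hoelder is replaced by direct arguments: for [q = 1] the weight is [1], and for [q = oo] the
    essential supremum of [psi] comes out of the integral. *)
Lemma hoelder_dist2 q w psi : (1 <= q)%E -> cabs w < 1 ->
    cmeasurableT psi -> (Lpnorm q psi < +oo)%E ->
  (\int[mu]_t (cabs (psi t) * dist2 w t `^ (- (four_over_conj q / 4)))%:E <=
   Lpnorm q psi * (min_norm q w)%:E)%E.
Proof.
move=> q1 w1 mpsi psioo; have r1 : 0 < 1 - cabs2 w by rewrite subr_gt0 cabs2_lt1.
have mc := cmeasurableT_cabs mpsi.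
have md e := @measurable_dist2_pow R e w w1.
case: q q1 psioo => [q| |]//= q1 psioo; last first.
- rewrite /min_norm/= divff//.
  rewrite Lpnorm_infty in psioo *; set N := ess_sup _ _ in psioo *.
  have N0 : (0 <= N)%E.
    apply: ess_sup_gee; first exact: circ_measureT_gt0.
    by apply: nearW => t /=.
  have Nfin : N \is a fin_num by rewrite ge0_fin_numE.
  have -> : (1 - cabs2 w) `^ (-1) = szego_mean 1 w.
    by rewrite szego_mean1// powR_inv1// ltW.
  have -> : (N * (szego_mean 1 w)%:E =
      \int[mu]_t (fine N * dist2 w t `^ (-1))%:E)%E.
    have iN := integrableZl measurableT (fine N) (integrable_dist2_pow (-1) w1).
    rewrite -[N in LHS]fineK// -EFinM /szego_mean -RintegralZl//; last first.
      exact: integrable_dist2_pow.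
    rewrite /Rintegral fineK//; apply: integral_fune_fin_num => //.
  apply: ae_ge0_le_integral => //.
  + by move=> t _; rewrite lee_fin mulr_ge0 ?cabs_ge0 ?powR_ge0.
  + by apply/measurable_EFinP; apply: measurable_funM => //; exact: md.
  + by move=> t _; rewrite lee_fin mulr_ge0 ?powR_ge0 ?fine_ge0.
  + by apply/measurable_EFinP; apply: measurable_funM => //; exact: md.
  apply: filterS (ess_sup_ge mu (abse \o (fun t => (cabs (psi t))%:E))) => t /= ht _.
  rewrite lee_fin ler_wpM2r ?powR_ge0// -lee_fin fineK//.
  by apply: le_trans ht; rewrite lee_fin ler_norm.
rewrite lee_fin le_eqVlt in q1; case/predU1P: q1 => [q1|q1].
- rewrite -q1 /min_norm/= invr1 subrr mulr0 mul0r oppr0 powRr0 mule1.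
  rewrite /Lpnorm Lnorm1 le_eqVlt; apply/orP; left; apply/eqP.
  apply: eq_integral => t _; rewrite powRr0 mulr1 /= ger0_norm//.
  exact: cabs_ge0.
have q0 : 0 < q by exact: lt_trans q1.
pose q' := q / (q - 1).
have q'0 : 0 < q' by rewrite divr_gt0 ?subr_gt0.
have qq' : q^-1 + q'^-1 = 1.
  by rewrite /q'; field; rewrite !gt_eqF// subr_gt0.
set e := - (_ / 4).
have /= := @hoelder _ _ _ mu (fun t => cabs (psi t)) (fun t => dist2 w t `^ e) q q'
  mc (md e) q0 q'0 qq'.
have -> : Lnorm mu q'%:E (EFin \o (fun t => dist2 w t `^ e)) =
    (min_norm q%:E w)%:E.
  transitivity (Lpnorm q'%:E (fun t => (dist2 w t `^ e)%:C)).
    rewrite /Lpnorm; congr Lnorm; apply/funext => t.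
    by rewrite /comp cabs_real ger0_norm ?powR_ge0.
  rewrite (@Lpnorm_dist2_pow _ _ 1 e q' w w1 ler01 q'0); last first.
    by move=> t; rewrite cabs_real mul1r ger0_norm ?powR_ge0.
  rewrite (_ : - (e * q') = 1); last first.
    by rewrite /e /q'/=; field; rewrite !gt_eqF// subr_gt0.
  rewrite szego_mean1// mul1r -(powR_inv1 (ltW r1)) -powRrM /min_norm/=.
  by congr (_ `^ _)%:E; rewrite /q'; field; rewrite !gt_eqF// subr_gt0.
apply: le_trans; rewrite Lnorm1 le_eqVlt; apply/orP; left; apply/eqP.
apply: eq_integral => t _ /=; rewrite ger0_norm// mulr_ge0 ?powR_ge0//.
exact: cabs_ge0.
Qed.

(** At [w = 0] the weight of [hoelder_dist2] is [1], and that inequality reads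
    [||psi||_1 <= ||psi||_q]. *)
Lemma cmeasurableT_Lq_integrable q psi : (1 <= q)%E -> cmeasurableT psi ->
  (Lpnorm q psi < +oo)%E -> cintegrable psi.
Proof.
move=> q1 mpsi psioo; have c0 : cabs (0 : R[i]) < 1.
  by rewrite -[0]/(0%:C) cabs_real normr0.
have := hoelder_dist2 q1 c0 mpsi psioo.
have -> : min_norm q (0 : R[i]) = 1.
  by rewrite /min_norm /cabs2/= expr0n addr0 subr0 powR1.
rewrite mule1 => h; apply: (le_cintegrable mpsi _ (fun t => lexx _)).
have mc := cmeasurableT_cabs mpsi.
apply/integrableP; split; first exact/measurable_EFinP.
apply: le_lt_trans psioo; apply: le_trans h; rewrite le_eqVlt; apply/orP; left.
apply/eqP; apply: eq_integral => t _.
rewrite (_ : dist2 0 t = 1) ?powR1 ?mulr1 /= ?ger0_norm ?cabs_ge0//.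
by rewrite /dist2 /disk_pt /cconj/= oppr0 -[_ +i* _]/(0 : R[i]) mul0r subr0 cabs2E cabs1 expr1n.
Qed.

Lemma min_norm_le_measurable q w psi : (1 <= q)%E -> cabs w < 1 ->
    cmeasurableT psi -> (Lpnorm q psi < +oo)%E -> Pplus_is_kernel psi w ->
  ((min_norm q w)%:E <= Lpnorm q psi)%E.
Proof.
move=> q1 w1 mpsi psioo ker.
have r0 := cabs2_ge0 w; have r1 := cabs2_lt1 w1.
have r1p : 0 < 1 - cabs2 w by rewrite subr_gt0.
have ipsi := cmeasurableT_Lq_integrable q1 mpsi psioo.
pose s := four_over_conj q / 2.
have [B hB] := binom_fun_bound s w1.
pose g t := psi t * cconj (binom_fun s (disk_pt w t)) * expi (- (0%:R * t)).
have ig : cintegrable g.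
  apply: (@cintegrableMl _ _ _ 1); last by move=> t; rewrite cabs_expi.
    apply: (@cintegrableMl _ _ _ B) => //.
      by apply: cmeasurableT_conj; exact: binom_fun_measurable.
    by move=> t; rewrite cabs_conj.
  exact: cmeasurableT_expiN.
have gE : cint g = ((1 - cabs2 w) `^ (- s))%:C.
  have hs := @binom_series R s _ r0 r1.
  apply: ccvg_unique (cint_conj_binom_fun s 0 w1 ipsi) _.
  rewrite (_ : (fun N => _) = (fun N => (pseries (binom_coef s) (cabs2 w) N)%:C)).
    by split; [exact: hs|exact: cvg_cst].
  apply/funext => N; rewrite /pseries /series/= rmorph_sum.
  apply: eq_bigr => j _; rewrite add0n ker rmorphM rmorphXn/= -mulr_cconj exprMn.
  ring.
have cg t : cabs (g t) = cabs (psi t) * dist2 w t `^ (- (four_over_conj q / 4)).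
  rewrite /g !cabsM cabs_expi mulr1 cabs_conj cabs_pow_dist2//; congr (_ * _ `^ _).
  by rewrite /s; field.
have h1 : (((1 - cabs2 w) `^ (- s))%:E <= \int[mu]_t (cabs (g t))%:E)%E.
  have -> : (1 - cabs2 w) `^ (- s) = Rintegral mu setT (Re \o g).
    by rewrite -[LHS]/(Re ((1 - cabs2 w) `^ (- s))%:C) -gE.
  rewrite /Rintegral fineK; last first.
    by apply: integral_fune_fin_num => //; case: ig.
  apply: le_integral => //; first by case: ig.
    exact: cintegrable_cabs.
  by move=> t _; rewrite lee_fin (le_trans (ler_norm _))// normr_Re_le.
have h2 : (((1 - cabs2 w) `^ (- s))%:E <= Lpnorm q psi * (min_norm q w)%:E)%E.
  apply: le_trans h1 (le_trans _ (hoelder_dist2 q1 w1 mpsi psioo)).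
  by under eq_integral do rewrite cg.
have m0 : 0 < min_norm q w by rewrite powR_gt0.
(* With [m = min_norm q w], the pairing has value [m^2] while Hoelder bounds it by [m ||psi||_q];
   one factor [m] cancels. *)
have mm : (1 - cabs2 w) `^ (- s) = min_norm q w * min_norm q w.
  rewrite -powRD; last by rewrite (gt_eqF r1p) implybT.
  by congr (_ `^ _); rewrite /s; field.
have := Lnorm_ge0 mu q (fun t => (cabs (psi t))%:E).
rewrite -/(Lpnorm q psi); move: h2 psioo; rewrite mm.
case: (Lpnorm q psi) => [l| |]// h2 _ _.
by move: h2; rewrite -EFinM !lee_fin ler_pM2r.
Qed.

(** The measure lives on [circD], so replacing [psi] by [0] elsewhere changes neither norm nor
    coefficients and gives measurability on the whole line. *)
Lemma min_norm_le q w psi : (1 <= q)%E -> cabs w < 1 ->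
  inLq q psi -> Pplus_is_kernel psi w -> ((min_norm q w)%:E <= Lpnorm q psi)%E.
Proof.
move=> q1 w1 [[m1 m2] psioo] ker.
pose phi t := if t \in (@circD R) then psi t else 0.
have pE t : circD t -> phi t = psi t by move=> Dt; rewrite /phi mem_set.
rewrite -(eq_Lpnorm_circ q1 pE); apply: min_norm_le_measurable => //.
- split.
    move/(measurable_restrictT _ (@measurable_circD R)): m1.
    apply: eq_measurable_fun => t _; rewrite patchE /= /phi.
    by case: ifP.
  move/(measurable_restrictT _ (@measurable_circD R)): m2.
  apply: eq_measurable_fun => t _; rewrite patchE /= /phi.
  by case: ifP.
- by rewrite (eq_Lpnorm_circ q1 pE).
- by move=> n; rewrite (eq_fourier_circ _ pE).
Qed.

End MinimalNorm.

(** * Comparison of the norms *)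

Section SzegoNorm.
Context {R : realType}.
Local Open Scope complex_scope.
Implicit Types (w : R[i]) (p : R) (q : \bar R).

Lemma pow_mean_root (x p : R) : 0 < p ->
  (x `^ (- (p / 2) ^+ 2)) `^ p^-1 = x `^ (- (p / 4)).
Proof. by move=> p0; rewrite -powRrM; congr (_ `^ _); field; rewrite gt_eqF. Qed.

Lemma pnorm_szego_le p w : 0 <= p -> cabs w < 1 ->
  (pnorm p (szego w) <= ((1 - cabs2 w) `^ (- (p / 4)))%:E)%E.
Proof.
rewrite le_eqVlt => /predU1P[<- w1|p0 w1].
  by rewrite /pnorm eqxx L0norm_szego// mul0r oppr0 powRr0.
rewrite pnorm_szego// lee_fin -(pow_mean_root _ p0).
apply: ge0_ler_powR; rewrite ?nnegrE ?szego_mean_ge0 ?powR_ge0 ?invr_ge0 ?(ltW p0)//.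
exact: szego_mean_le.
Qed.

Lemma pnorm_szego_lt p w : 0 < p -> p != 2 -> cabs w < 1 -> w != 0 ->
  (pnorm p (szego w) < ((1 - cabs2 w) `^ (- (p / 4)))%:E)%E.
Proof.
move=> p0 p2 w1 w0; rewrite pnorm_szego// lte_fin -(pow_mean_root _ p0).
apply: gt0_ltr_powR; rewrite ?invr_gt0 ?nnegrE ?szego_mean_ge0 ?powR_ge0//.
apply: szego_mean_lt => //.
- by rewrite gt_eqF// divr_gt0.
- by apply: contra p2 => /eqP h; apply/eqP; lra.
- rewrite lt_def cabs2_ge0 andbT cabs2E sqrf_eq0.
  by apply: contra w0 => /eqP /ComplexField.Normc.eq0_normc ->.
Qed.

Lemma pnorm_szego0 w : cabs w < 1 -> pnorm 0 (szego w) = 1%E.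
Proof. by move=> w1; rewrite /pnorm eqxx L0norm_szego. Qed.

Lemma pnorm_szego2 w : cabs w < 1 ->
  pnorm 2 (szego w) = ((1 - cabs2 w) `^ (- (2 / 4)))%:E.
Proof.
move=> w1; have r1 : 0 < 1 - cabs2 w by rewrite subr_gt0 cabs2_lt1.
rewrite pnorm_szego// divff// szego_mean1// -(powR_inv1 (ltW r1)) -powRrM.
by congr (_ `^ _)%:E; lra.
Qed.

(** For [p > 0] the upper and lower bounds on the mean meet at [1] when [r = 0]. *)
Lemma pnorm_szego_w0 p : 0 <= p -> pnorm p (szego (0 : R[i])) = 1%E.
Proof.
move=> p0; have c0 : cabs (0 : R[i]) < 1 by rewrite -[0]/(0%:C) cabs_real normr0.
have r0 : cabs2 (0 : R[i]) = 0 by rewrite /cabs2/= expr0n addr0.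
move: p0; rewrite le_eqVlt => /predU1P[<-|p0]; first exact: pnorm_szego0.
apply/eqP; rewrite eq_le; apply/andP; split.
  by have := pnorm_szego_le (ltW p0) c0; rewrite r0 subr0 powR1.
rewrite pnorm_szego// lee_fin [leLHS](_ : 1 = 1 `^ p^-1); last by rewrite powR1.
apply: ge0_ler_powR; rewrite ?nnegrE ?szego_mean_ge0 ?invr_ge0 ?(ltW p0)//.
by have := szego_mean_ge (p / 2) c0; rewrite r0 mulr0 addr0.
Qed.

(* [p^2/4] and [p k/4] are the first-order coefficients in [|w|^2] of
   [||k_w||_p^p] and of [(1 - |w|^2)^(-p k/4)]. *)
Lemma pnorm_szego_gt p k : 0 <= k -> k < p -> exists2 w, cabs w < 1 &
  (((1 - cabs2 w) `^ (- (k / 4)))%:E < pnorm p (szego w))%E.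
Proof.
move=> k0 kp; have p0 : 0 < p by exact: le_lt_trans kp.
pose a := p ^+ 2 / 4; pose b := p * k / 4.
have b0 : 0 <= b by rewrite divr_ge0// mulr_ge0// ltW.
have ab : b < a by rewrite /a /b ltr_pM2r// expr2 ltr_pM2l.
have a0 : 0 < a by exact: le_lt_trans ab.
(* The final comparison [(1 - r)/(1 - r - b r) < 1 + a r] amounts to [a r (1 + b) < a - b]; this [r]
   makes the left side half of the right one. *)
pose r := (a - b) / (2 * a * (1 + b)).
have den : 0 < 2 * a * (1 + b) by rewrite !mulr_gt0//; lra.
have r0 : 0 < r by rewrite divr_gt0// subr_gt0.
have rE : r * (2 * a * (1 + b)) = a - b by rewrite divfK// gt_eqF.
have rb : r * (1 + b) <= 1 / 2.
  rewrite -(ler_pM2r a0); nra.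
have r1 : r < 1 by nra.
have wr : cabs2 (Num.sqrt r)%:C = r.
  by rewrite cabs2E cabs_real ger0_norm ?sqrtr_ge0// sqr_sqrtr// ltW.
have w1 : cabs (Num.sqrt r)%:C < 1.
  by rewrite cabs_real ger0_norm ?sqrtr_ge0// -sqrtr1 ltr_sqrt.
exists (Num.sqrt r)%:C => //; rewrite pnorm_szego// lte_fin wr.
have -> : (1 - r) `^ (- (k / 4)) = ((1 - r) `^ (- b)) `^ p^-1.
  by rewrite -powRrM; congr (_ `^ _); rewrite /b; field; rewrite gt_eqF.
apply: gt0_ltr_powR; rewrite ?invr_gt0 ?nnegrE ?szego_mean_ge0 ?powR_ge0//.
apply: lt_le_trans (szego_mean_ge (p / 2) w1); rewrite wr.
rewrite (_ : (p / 2) ^+ 2 = a); last by rewrite /a; field.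
have d0 : 0 < 1 - r - b * r by nra.
(* A rational majorant of [(1 - r)^(-b)]: from [- ln (1 - r) <= r/(1 - r)] and [e^(-x) >= 1 - x]
   follows [(1 - r)^b >= 1 - b r/(1 - r)]. *)
apply: (@le_lt_trans _ _ ((1 - r) / (1 - r - b * r))).
  have r1p : 0 < 1 - r by rewrite subr_gt0.
  have lnb : - ln (1 - r) <= r / (1 - r).
    have x0 : 0 <= r / (1 - r) by rewrite divr_ge0 ?ltW.
    rewrite -lnV ?posrE// [X in ln X](_ : _ = 1 + r / (1 - r)).
      by rewrite le_ln1Dx// (lt_le_trans _ x0)// ltrN10.
    by field; rewrite gt_eqF.
  rewrite powRN /powR (gt_eqF r1p) -expRN.
  rewrite -[leRHS]invf_div -[leLHS]invrK lef_pV2 ?posrE ?invr_gt0 ?expR_gt0 ?divr_gt0//.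
  rewrite -expRN opprK; apply: le_trans (expR_ge1Dx _).
  have -> : (1 - r - b * r) / (1 - r) = 1 - b * (r / (1 - r)).
    by field; rewrite gt_eqF.
  have := ler_wpM2l b0 lnb; set x := b * (r / _); rewrite mulrN => h.
  lra.
rewrite ltr_pdivrMr//; nra.
Qed.

End SzegoNorm.

(** * The exponent [4/q^*] and the conclusion *)

Section ConjugateExponent.
Context {R : realType}.
Implicit Types (w : R[i]) (q : \bar R).

Lemma four_over_conj_ge0 q : (1 <= q)%E -> 0 <= four_over_conj q.
Proof.
case: q => [r| |]//=; rewrite lee_fin => r1; rewrite mulr_ge0// subr_ge0.
by rewrite invf_le1// (lt_le_trans ltr01).
Qed.

Lemma four_over_conj_eq0 q : (1 <= q)%E -> four_over_conj q = 0 -> q = 1%E.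
Proof.
case: q => [r| |]//=; rewrite ?lee_fin => r1 /eqP; last by rewrite pnatr_eq0.
rewrite mulf_eq0 pnatr_eq0/= subr_eq0 eq_sym invr_eq1 => /eqP ->//.
Qed.

Lemma four_over_conj_eq2 q : (1 <= q)%E -> four_over_conj q = 2 -> q = 2%:E.
Proof.
case: q => [r| |]//=; rewrite ?lee_fin => r1 h; last by move/eqP: h; rewrite eqr_nat.
by congr (_%:E); rewrite -[LHS]invrK -[RHS]invrK; congr (_^-1); lra.
Qed.

Lemma Lq_minimal_norm q w psi : (1 <= q)%E -> cabs w < 1 ->
  Lq_minimal q w psi -> Lpnorm q psi = (min_norm q w)%:E.
Proof.
move=> q1 w1 [psiq [ker min]]; apply/eqP; rewrite eq_le min_norm_le// andbT.
rewrite -(Lpnorm_extremal q1 w1); apply: min; first exact: extremal_inLq.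
exact: extremal_fourier.
Qed.

End ConjugateExponent.

Theorem theorem8 (R : realType) (q : \bar R) (hq : (1%:E <= q)%E) :
  (forall p : R, 0 <= p ->
     ((forall w : R[i], cabs w < 1 ->
         forall psi : R -> R[i], inLq q psi -> Pplus_is_kernel psi w ->
           (pnorm p (szego w) <= Lpnorm q psi)%E)
      <-> p <= four_over_conj q)) /\
  ((q = 1%:E \/ q = 2%:E) ->
     forall w : R[i], cabs w < 1 ->
       forall psi : R -> R[i], Lq_minimal q w psi ->
         Lpnorm q psi = pnorm (four_over_conj q) (szego w)) /\
  ((q <> 1%:E /\ q <> 2%:E) ->
     forall w : R[i], cabs w < 1 ->
       forall psi : R -> R[i], Lq_minimal q w psi ->
         (Lpnorm q psi = pnorm (four_over_conj q) (szego w) <-> w = 0)).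
Proof.
have k0 := four_over_conj_ge0 hq.
split; [|split].
- move=> p p0; split=> [contr|pk w w1 psi psiq ker].
    rewrite leNgt; apply/negP => kp.
    (* The supposed inequality is tested on the extremal function at a point [w] where its norm lies
       strictly below [||k_w||_p]. *)
    have [w w1] := pnorm_szego_gt k0 kp.
    rewrite ltNge => /negP; apply.
    have := contr w w1 _ (extremal_inLq hq w1) (extremal_fourier q w1).
    by rewrite Lpnorm_extremal.
  apply: le_trans (pnorm_szego_le p0 w1) (le_trans _ (min_norm_le hq w1 psiq ker)).
  rewrite lee_fin /min_norm /powR.
  have r1 : 0 < 1 - cabs2 w by rewrite subr_gt0 cabs2_lt1.
  rewrite (gt_eqF r1) ler_expR !mulNr lerN2 ler_wnM2r//.
    by rewrite ln_le0// lerBlDr lerDl cabs2_ge0.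
  by rewrite ler_pM2r// invr_gt0.
- move=> q12 w w1 psi mpsi; rewrite (Lq_minimal_norm hq w1 mpsi) /min_norm.
  case: q12 => ->/=.
    by rewrite invr1 subrr mulr0 pnorm_szego0// mul0r oppr0 powRr0.
  by rewrite (_ : 4 * (1 - 2^-1) = 2) ?pnorm_szego2//; lra.
- move=> [q1 q2] w w1 psi mpsi; rewrite (Lq_minimal_norm hq w1 mpsi) /min_norm.
  (* The norm bound for [k_w] is an equality for every [w] at [p = 0] and [p = 2]; excluding [q = 1]
     and [q = 2] excludes exactly these values of [4/q^*]. *)
  have kp : 0 < four_over_conj q.
    rewrite lt_def k0 andbT; apply/eqP => /(four_over_conj_eq0 hq); exact: q1.
  have k2 : four_over_conj q != 2.
    by apply/eqP => /(four_over_conj_eq2 hq); exact: q2.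
  split=> [h|->].
    apply/eqP; apply: contraT => w0.
    by have := pnorm_szego_lt kp k2 w1 w0; rewrite -h ltxx.
  rewrite pnorm_szego_w0// /cabs2/= expr0n addr0 subr0 powR1//.
Qed.
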